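(* Let $a,b,c\in\mathbb{R}$ with $a\ne0$, and let $x_n=an^2+bn+c$ for $n\ge1$. Then for almost every $\alpha\in\mathbb{R}$, $$\delta_{\min}^{\alpha}(N)<\frac{1}{N^{2-o(1)}},$$ where the rate of decay of the $o(1)$ term depends on $\alpha$.
   Context: For $x\in\mathbb{R}$, $\|x\|=\min_{k\in\mathbb{Z}}|x-k|$. For $\alpha\in\mathbb{R}$, $\delta_{\min}^{\alpha}(N)=\min\{\|\alpha x_m-\alpha x_n\| : 1\le m,n\le N,\ m\ne n\}$. The notation $\frac{1}{N^{2-o(1)}}$ means $N^{-(2-f_\alpha(N))}$ for some function $f_\alpha(N)\to0$ as $N\to\infty$, the inequality holding for all sufficiently large $N$. *)

(* Defs.v *)
From HB Require Import structures.
From mathcomp Require Import all_boot all_order all_algebra.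
From mathcomp Require Import all_classical all_reals all_analysis.
Set Implicit Arguments. Unset Strict Implicit. Unset Printing Implicit Defensive.
Import Order.TTheory GRing.Theory Num.Theory.
Import numFieldNormedType.Exports.
Local Open Scope classical_set_scope.
Local Open Scope ring_scope.

(* ||x|| = distance from x to the nearest integer = min_{k in Z} |x - k|
   (the infimum is attained, so inf = min) *)
Definition dist_int (R : realType) (x : R) : R :=
  inf [set `|x - k%:~R| | k in [set: int]].

Definition quad_seq (R : realType) (a b c : R) (n : nat) : R :=
  a * n%:R ^+ 2 + b * n%:R + c.

(* delta_min^alpha(N) = min { ||alpha x_m - alpha x_n|| : 1 <= m,n <= N, m <> n }
   (a finite nonempty set for N >= 2, so inf = min) *)
Definition delta_min (R : realType) (x : nat -> R) (alpha : R) (N : nat) : R :=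
  inf ((fun mn : nat * nat => dist_int (alpha * x mn.1 - alpha * x mn.2)) @`
       [set mn : nat * nat |
          [/\ (1 <= mn.1 <= N)%N, (1 <= mn.2 <= N)%N & mn.1 != mn.2]]).

(* Main.v *)
Require Import Defs.
From HB Require Import structures.
From mathcomp Require Import all_boot all_order all_algebra.
From mathcomp Require Import complex.
From mathcomp Require Import all_classical all_reals all_analysis.
From mathcomp Require Import measurable_realfun.
From mathcomp Require Import zify ring lra.
Import Order.TTheory GRing.Theory Num.Theory.
Import numFieldNormedType.Exports.
Set Implicit Arguments. Unset Strict Implicit. Unset Printing Implicit Defensive.

(** The gaps of the sequence are x_(n+d) - x_n = d (a (2n + d) + b).  Let q = 2^j,
    N = q^r, and let these gaps run over d <= N < n <= 2N.  Fix a nonnegative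
    trigonometric polynomial K (a power of a Fejer kernel) of degree about
    q^(2r-4) which is at most half of its mean c0 at distance at least q^-(2r-5)
    from the integers.  If alpha times every gap stays that far from the
    integers, then the sum of K(alpha gap) over the N^2 gaps deviates from its
    mean by at least N^2 c0 / 2.  By Chebyshev this happens on a set of measure
    O(1/q) of bounded alpha, because the mean square of the deviation is
    controlled by the number of pairs of frequencies h d (a (2n + d) + b) lying
    in a common unit interval.  The divisor bound reduces the latter to counting
    u, u', s, s' with |u (s + g) - u' (s' + g)| bounded; for fixed s, s' the
    possible u are separated by the least denominator v for which v (s + g) is
    close to a multiple of s' + g, and for coprime v, v' the number of pairs
    (s, s') is O(N / v), so the total is O(log N) times the diagonal
    contribution.  Borel-Cantelli over j gives minimal gaps below
    N^-(2 - 6/r) eventually, for every r. *)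

(** * The divisor bound *)

(** A divisor [e] splits as [gcdn e (p ^ a)], some [p ^ i] with [i <= a], times a cofactor dividing
    [m]. *)
Lemma size_divisors_pfactorM p a m : prime p -> 0 < m ->
  size (divisors (p ^ a * m)) <= a.+1 * size (divisors m).
Proof.
move=> pp m0.
have -> : a.+1 * size (divisors m) =
  size [seq p ^ i * d | i <- iota 0 a.+1, d <- divisors m].
  by rewrite size_allpairs size_iota.
apply: uniq_leq_size (divisors_uniq _) _ => e.
have pam0 : 0 < p ^ a * m by rewrite muln_gt0 expn_gt0 prime_gt0.
rewrite -dvdn_divisors // => de; have e0 := dvdn_gt0 pam0 de.
have /(dvdn_pfactor _ _ pp)[i ia Ei] := dvdn_gcdr e (p ^ a).
apply/allpairsP; exists (i, e %/ gcdn e (p ^ a)); split.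
- by rewrite mem_iota add0n ltnS.
- rewrite /= -dvdn_divisors // -(@dvdn_pmul2l (gcdn e (p ^ a))) ?gcdn_gt0 ?e0 //.
  by rewrite mulnC divnK ?dvdn_gcdl // muln_gcdl dvdn_gcd dvdn_mulr.
- by rewrite /= -Ei mulnC divnK // dvdn_gcdl.
Qed.

(** With [t = a %/ K], the chain [a + 1 <= K (t + 1) <= K 2 ^ t] is raised to the power [K]. This is
    the cost of a small prime in the divisor bound. *)
Lemma expn_succ_le K a : 0 < K -> a.+1 ^ K <= K ^ K * 2 ^ a.
Proof.
move=> K0.
have h : a.+1 <= K * 2 ^ (a %/ K).
  apply: (@leq_trans (K * (a %/ K).+1)); first by have := ltn_ceil a K0; lia.
  by rewrite leq_mul2l ltn_expl ?orbT.
apply: (@leq_trans ((K * 2 ^ (a %/ K)) ^ K)); first by rewrite leq_exp2r.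
by rewrite expnMn leq_mul2l -expnM leq_pexp2l ?orbT // leq_divM.
Qed.

Lemma pfactor_split p n : prime p -> 0 < n -> p %| n ->
  exists a m, [/\ n = p ^ a * m, 0 < m, m < n & ~~ (p %| m)].
Proof.
move=> pp n0 pn; have [m cpm def_n] := pfactor_coprime pp n0.
exists (logn p n), m; rewrite prime_coprime // in cpm.
have m0 : 0 < m by case: (m) cpm; rewrite ?dvdn0.
split=> //; first by rewrite mulnC.
by rewrite def_n ltn_Pmulr // -(exp1n (logn p n)) ltn_exp2r ?prime_gt1 // logn_gt0 mem_primes pp n0.
Qed.

(* Primes p >= 2 ^ K contribute at most p ^ a to the K-th power of the divisor
   count; each of the finitely many smaller primes costs a factor K ^ K. *)
Lemma size_divisors_rough K b n : 0 < K -> 0 < n ->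
  (forall p, prime p -> p %| n -> 2 ^ K <= p + b) ->
  size (divisors n) ^ K <= (K ^ K) ^ b * n.
Proof.
move=> K0; elim: b n => [|b IHb] n.
  rewrite expn0 mul1n; elim/ltn_ind: n => n IHn n0 hn.
  have [->|n1] := eqVneq n 1; first by rewrite exp1n.
  have n_gt1 : 1 < n by lia.
  have pp := pdiv_prime n_gt1; have pn := pdiv_dvd n.
  have [a [m [def_n m0 mn npm]]] := pfactor_split pp n0 pn.
  have mdvd : m %| n by rewrite def_n dvdn_mull.
  have := IHn m mn m0 (fun p pp pm => hn p pp (dvdn_trans pm mdvd)).
  have := hn _ pp pn; rewrite addn0 => hp hm.
  have := size_divisors_pfactorM a pp m0; rewrite -def_n => hd.
  apply: (@leq_trans ((a.+1 * size (divisors m)) ^ K)); first by rewrite leq_exp2r.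
  rewrite expnMn def_n leq_mul //.
  apply: (@leq_trans ((2 ^ K) ^ a)); last first.
    by case: (a) => // a'; rewrite leq_exp2r.
  by rewrite -expnM mulnC expnM leq_exp2r // ltn_expl.
move=> n0 hn.
have KK0 : 0 < K ^ K by rewrite expn_gt0 K0.
(* Passing from [b] to [b.+1] admits a single new prime factor, [2 ^ K - b.+1]. If it divides [n] it
   is split off at the cost [K ^ K]; otherwise the induction hypothesis applies to [n] itself. *)
have [/andP[pp pn]|] := boolP (prime (2 ^ K - b.+1) && (2 ^ K - b.+1 %| n)); last first.
  move=> hp; have {hn}hn p : prime p -> p %| n -> 2 ^ K <= p + b.
    move=> pp pn; have := hn p pp pn; rewrite leq_eqVlt => /orP[/eqP E|]; last by lia.
    by move: hp; rewrite (_ : 2 ^ K - b.+1 = p) ?pp ?pn //; lia.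
  apply: leq_trans (IHb n n0 hn) _.
  by rewrite expnS -mulnA leq_pmull.
have [a [m [def_n m0 mn npm]]] := pfactor_split pp n0 pn.
have mdvd : m %| n by rewrite def_n dvdn_mull.
have hm : forall p, prime p -> p %| m -> 2 ^ K <= p + b.
  move=> p pr pm; have := hn p pr (dvdn_trans pm mdvd).
  rewrite leq_eqVlt => /orP[/eqP E|]; last by lia.
  by move: npm; rewrite (_ : 2 ^ K - b.+1 = p) ?pm //; lia.
have := IHb m m0 hm.
have := size_divisors_pfactorM a pp m0; rewrite -def_n => hd hm'.
apply: (@leq_trans ((a.+1 * size (divisors m)) ^ K)); first by rewrite leq_exp2r.
rewrite expnMn def_n expnS.
apply: (@leq_trans ((K ^ K * 2 ^ a) * ((K ^ K) ^ b * m))).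
  by apply: leq_mul => //; apply: expn_succ_le.
rewrite -!mulnA leq_mul2l mulnCA leq_mul2l leq_mul2r.
by apply/orP; right; apply/orP; right; apply/orP; right; case: (a) => // a'; rewrite leq_exp2r // prime_gt1.
Qed.

(** The divisor bound d(n) = O(n^(1/K)): for [b = 2 ^ K] the condition on the prime factors holds
    trivially. *)
Lemma size_divisors_le K : 0 < K ->
  exists C, forall n, 0 < n -> size (divisors n) ^ K <= C * n.
Proof.
move=> K0; exists ((K ^ K) ^ (2 ^ K)) => n n0.
by apply: size_divisors_rough => // p _ _; rewrite leq_addl.
Qed.

Local Open Scope ring_scope.

(** * Near coincidences between products *)

Lemma truncn_eq_lt1 (R : archiRealFieldType) (x y : R) :
  0 <= x -> 0 <= y -> Num.truncn x = Num.truncn y -> `|x - y| < 1.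
Proof.
move=> /truncn_itv/andP[x1 x2] /truncn_itv/andP[y1 y2] E; rewrite E in x1 x2.
by move: x2 y2; rewrite -!natr1 => x2 y2; rewrite ltr_norml; lra.
Qed.

Lemma natr_dist_lt1 (R : realDomainType) (a b c d : nat) :
  `|(a%:R - b%:R) - (c%:R - d%:R) : R| < 1 -> (a + d = c + b)%N.
Proof.
rewrite (_ : _ - _ = (a + d)%:R - (c + b)%:R :> R); last by rewrite !natrD; ring.
rewrite ltr_norml => /andP[h1 h2]; apply/eqP; rewrite eqn_leq.
by apply/andP; split; rewrite -ltnS -(ltr_nat R) -natr1; lra.
Qed.

Lemma coprime_modn_cancel (d m a b : nat) :
  coprime d m -> (m * a = m * b %[mod d])%N -> (a = b %[mod d])%N.
Proof.
move=> cop; wlog ba : a b / (b <= a)%N => [hw|].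
  by have [/hw//|/ltnW/hw h E] := leqP b a; apply/esym/h.
by move/eqP; rewrite eqn_mod_dvd ?leq_mul2l ?ba ?orbT // -mulnBr Gauss_dvdr // -eqn_mod_dvd // => /eqP.
Qed.

(** A pair is determined by the unit cell of the shifted form and by [p.2 %/ v]. Within one cell the
    integer [v p.1 - v' p.2] is constant, since the contribution of [g] cancels; coprimality then
    fixes [p.2] modulo [v], and [p.1] follows. *)
Lemma card_coprime_near (R : archiRealFieldType) (M v v' : nat) (g T : R) :
  (0 < v)%N -> coprime v v' -> 0 < T ->
  (#|[set p : 'I_M * 'I_M |
      `|v%:R * (p.1%:R + g) - v'%:R * (p.2%:R + g)| < T]%R| <=
    (Num.truncn (2 * T)).+1 * (M %/ v).+1)%N.
Proof.
move=> v0 cop T0.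
pose F (p : 'I_M * 'I_M) := v%:R * (p.1%:R + g) - v'%:R * (p.2%:R + g) + T.
pose f (p : 'I_M * 'I_M) : 'I_(Num.truncn (2 * T)).+1 * 'I_(M %/ v).+1 :=
  (inord (Num.truncn (F p)), inord (p.2 %/ v)).
rewrite -[X in (_ <= X * _)%N]card_ord -[X in (_ <= _ * X)%N]card_ord -card_prod.
apply: (@leq_card_in _ _ f) => -[i i'] [k k']; rewrite !inE /=.
rewrite !ltr_norml => /andP[i1 i2] /andP[k1 k2] [E1 E2].
have Fi0 : 0 <= F (i, i') by rewrite /F /=; lra.
have Fk0 : 0 <= F (k, k') by rewrite /F /=; lra.
have bnd p : 0 <= F p -> F p < 2 * T -> (Num.truncn (F p) < (Num.truncn (2 * T)).+1)%N.
  by move=> p0 p1; rewrite ltnS le_truncn // ltW.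
move/(congr1 val): E1; rewrite /= !inordK; first last.
- by apply: bnd => //; rewrite /F /=; lra.
- by apply: bnd => //; rewrite /F /=; lra.
move/(congr1 val): E2; rewrite /= !inordK; first last.
- by rewrite ltnS leq_div2r // ltnW.
- by rewrite ltnS leq_div2r // ltnW.
move=> E2 /(truncn_eq_lt1 Fi0 Fk0).
rewrite (_ : _ - _ = (v * i)%:R - (v' * i')%:R - ((v * k)%:R - (v' * k')%:R)); last first.
  by rewrite /F /= !natrM; ring.
move=> /natr_dist_lt1 E.
have E' : (i' = k' %[mod v])%N.
  apply: (coprime_modn_cancel cop).
  rewrite -(modnMDl k) -[in RHS](modnMDl i) mulnC [(i * v)%N]mulnC.
  by congr (_ %% _)%N; lia.
have Ei' : i' = k'.
  by apply: val_inj; rewrite /= (divn_eq i' v) (divn_eq k' v) E2 E'.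
subst k'; congr pair; apply: val_inj => /=.
by apply/eqP; rewrite -(eqn_pmul2l v0); apply/eqP; lia.
Qed.

(** Each block of [g] consecutive values of [w.1] holds at most one solution: two solutions subtract
    to a form smaller than [2 * T], against the gap hypothesis or the lower bounds on [y] and
    [y']. *)
Lemma card_strip (R : realFieldType) (U g : nat) (y y' T : R) :
  (0 < g)%N -> 0 < T -> 2 * T <= y -> 2 * T <= y' ->
  (forall v v' : nat, (0 < v < g)%N -> 2 * T <= `|v%:R * y - v'%:R * y'|) ->
  (#|[set w : 'I_U.+1 * 'I_U.+1 | `|w.1%:R * y - w.2%:R * y'| < T]%R| <=
    (U %/ g).+1)%N.
Proof.
move=> g0 T0 Ty Ty' hg.
pose f (w : 'I_U.+1 * 'I_U.+1) : 'I_(U %/ g).+1 := inord (w.1 %/ g).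
rewrite -[X in (_ <= X)%N]card_ord; apply: (@leq_card_in _ _ f) => -[a a'] [b b'].
have key : forall a a' b b' : nat, (a %/ g = b %/ g)%N -> (b <= a)%N ->
  `|a%:R * y - a'%:R * y'| < T -> `|b%:R * y - b'%:R * y'| < T -> a = b /\ a' = b'.
  move=> {a a' b b'} a a' b b' E ba; rewrite !ltr_norml => /andP[a1 a2] /andP[b1 b2].
  have [ab|ab] := eqVneq a b.
    split=> //; subst b; have [ab'|ab'|//] := ltngtP a' b'.
      have : (a' + 1)%:R * y' <= b'%:R * y' by rewrite ler_pM2r ?ler_nat; [lia|lra].
      by rewrite natrD => ?; exfalso; lra.
    have : (b' + 1)%:R * y' <= a'%:R * y' by rewrite ler_pM2r ?ler_nat; [lia|lra].
    by rewrite natrD => ?; exfalso; lra.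
  have abg : (0 < a - b < g)%N.
    have := divn_eq a g; have := divn_eq b g; rewrite E.
    by have := ltn_pmod a g0; have := ltn_pmod b g0; move: ab ba; lia.
  have [ab'|ab'] := leqP b' a'.
    have := hg _ (a' - b')%N abg; rewrite natrB // natrB // => h.
    have : `|(a%:R - b%:R) * y - (a'%:R - b'%:R) * y'| < 2 * T.
      by rewrite ltr_norml; apply/andP; split; lra.
    by rewrite ltNge h.
  (* Here the second coordinates move the opposite way, so the two forms differ by at least
     [y + y'], which exceeds [2 * T]. *)
  have : (b + 1)%:R * y <= a%:R * y by rewrite ler_pM2r ?ler_nat; [lia|lra].
  have : (a' + 1)%:R * y' <= b'%:R * y' by rewrite ler_pM2r ?ler_nat; [lia|lra].
  by rewrite !natrD => ? ?; exfalso; lra.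
rewrite !inE /= => ha hb /(congr1 val); rewrite /= !inordK ?ltnS ?leq_div2r // -1?ltnS // => E.
have [ba|ab] := leqP b a.
  by have [? ?] := key a a' b b' E ba ha hb; congr pair; apply: val_inj.
by have [? ?] := key b b' a a' (esym E) (ltnW ab) hb ha; congr pair; apply: val_inj.
Qed.

(** [v] is the denominator of a reduced fraction [v' / v] close to [y / y']. The range [8 * v] makes
    the search for the numerator finite and suffices for the sizes of [y] and [y'] in use. *)
Definition near_denom (R : realFieldType) (y y' T : R) (v : nat) : bool :=
  (0 < v)%N && [exists v' : 'I_(8 * v).+1,
    coprime v v' && (`|v%:R * y - v'%:R * y'| < T)].

(** Dividing by the gcd shrinks the form and reduces the fraction. The numerator stays in range
    because [q N <= q y' < p y + T <= 8 p N]. *)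
Lemma near_denom_reduce (R : realFieldType) (N : nat) (y y' T : R) (v v' : nat) :
  (0 < N)%N -> N%:R <= y' -> y <= (7 * N)%:R -> 0 < T -> T <= N%:R ->
  (0 < v)%N -> `|v%:R * y - v'%:R * y'| < T ->
  exists2 p, (p <= v)%N & near_denom y y' T p.
Proof.
move=> N0 Ny' yN T0 TN v0 h.
have e0 : (0 < gcdn v v')%N by rewrite gcdn_gt0 v0.
set e := gcdn v v' in e0.
have /dvdnP[p Ep] : (e %| v)%N by apply: dvdn_gcdl.
have /dvdnP[q Eq] : (e %| v')%N by apply: dvdn_gcdr.
have p0 : (0 < p)%N by move: v0; rewrite Ep muln_gt0 => /andP[].
have cpq : coprime p q.
  by rewrite /coprime -(eqn_pmul2r e0) muln_gcdl -Ep -Eq mul1n.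
have h' : `|p%:R * y - q%:R * y'| < T.
  apply: le_lt_trans h; rewrite Ep Eq !natrM.
  have -> : p%:R * e%:R * y - q%:R * e%:R * y' = e%:R * (p%:R * y - q%:R * y') by ring.
  by rewrite normrM normr_nat ler_peMl // ler1n.
exists p; first by rewrite Ep leq_pmulr.
have q8 : (q <= 8 * p)%N.
  rewrite -(ler_nat R) natrM leNgt; apply/negP => qp.
  have N0' : 0 < N%:R :> R by rewrite ltr0n.
  have p1 : 1 <= p%:R :> R by rewrite ler1n.
  have h1 : p%:R * y <= p%:R * (7 * N%:R) by rewrite ler_pM2l ?ltr0n // -natrM.
  have h2 : q%:R * N%:R <= q%:R * y' by rewrite ler_wpM2l.
  have h3 : 8 * p%:R * N%:R < q%:R * N%:R :> R by rewrite ltr_pM2r.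
  have h4 : N%:R <= p%:R * N%:R :> R by rewrite ler_peMl // ltW.
  by move: h'; rewrite ltr_norml; lra.
by apply/andP; split=> //; apply/existsP; exists (@Ordinal (8 * p).+1 q q8); rewrite /= cpq.
Qed.

(** The separation of solutions is the least near denominator if that is at most [N], and [N]
    otherwise. Replacing the reciprocal of the least one by a sum over all of them prepares the
    exchange of summations over [y], [y'] and [v]. *)
Lemma card_strip_le (R : realFieldType) (N U : nat) (y y' T : R) :
  (0 < N)%N -> N%:R <= y -> N%:R <= y' -> y <= (7 * N)%:R ->
  0 < T -> 2 * T <= N%:R ->
  (#|[set w : 'I_U.+1 * 'I_U.+1 | `|w.1%:R * y - w.2%:R * y'| < T]|)%:R <=
    1 + U%:R / N%:R +
    U%:R * \sum_(v < N | near_denom y y' (2 * T) v.+1) (v.+1)%:R^-1 :> R.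
Proof.
move=> N0 Ny Ny' yN T0 TN.
have T0' : 0 < 2 * T by lra.
have gap g : (forall v, near_denom y y' (2 * T) v -> (g <= v)%N) ->
  forall v v' : nat, (0 < v < g)%N -> 2 * T <= `|v%:R * y - v'%:R * y'|.
  move=> hg v v' /andP[v0 vg]; rewrite leNgt; apply/negP => /(near_denom_reduce N0 Ny' yN T0' TN v0).
  by case=> p pv /hg; rewrite leqNgt (leq_ltn_trans pv vg).
have strip g : (0 < g)%N -> (forall v, near_denom y y' (2 * T) v -> (g <= v)%N) ->
  (#|[set w : 'I_U.+1 * 'I_U.+1 | `|w.1%:R * y - w.2%:R * y'| < T]|)%:R <= 1 + U%:R / g%:R :> R.
  move=> g0 /gap hg.
  have := card_strip U g0 T0 (le_trans TN Ny) (le_trans TN Ny') hg.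
  rewrite -(ler_nat R) => /le_trans -> //.
  rewrite -natr1 addrC lerD2l ler_pdivlMr ?ltr0n // -natrM ler_nat.
  exact: leq_divM.
have S0 : 0 <= \sum_(v < N | near_denom y y' (2 * T) v.+1) (v.+1)%:R^-1 :> R.
  by apply: sumr_ge0 => v _; rewrite invr_ge0.
have [/existsP[v hv]|] := boolP [exists v : 'I_N, near_denom y y' (2 * T) v.+1].
  have ex : exists v, near_denom y y' (2 * T) v by exists v.+1.
  have [g hg gmin] := ex_minnP ex.
  have g0 : (0 < g)%N by case/andP: hg.
  apply: le_trans (strip g g0 gmin) _.
  rewrite -addrA lerD2l -[X in X <= _]add0r; apply: lerD; first by rewrite divr_ge0.
  rewrite ler_wpM2l //.
  have gN : (g.-1 < N)%N by have := gmin _ hv; have := ltn_ord v; lia.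
  have E : (Ordinal gN).+1 = g :> nat by rewrite /= prednK.
  rewrite (bigD1 (Ordinal gN)) ?E //= ?prednK // lerDl.
  by apply: sumr_ge0 => ? _; rewrite invr_ge0.
rewrite negb_exists => /forallP hn.
apply: le_trans (strip N N0 _) _; last by rewrite lerDl mulr_ge0.
move=> v hv; rewrite leqNgt; apply/negP => vN.
have v0 : (0 < v)%N by case/andP: hv.
have vN' : (v.-1 < N)%N by lia.
by have := hn (Ordinal vN'); rewrite /= prednK // hv.
Qed.

(** After exchanging sums, each [v] is a near denominator for O(N) pairs [(i, i')]: there are
    [8 v + 1] possible numerators, with O(N / v) pairs for each. The weights [1 / v] leave a
    harmonic sum, hence only a logarithmic loss. *)
Lemma count_near_products (R : archiRealFieldType) (N M U : nat) (g T : R) :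
  (0 < N)%N -> (M <= 3 * N)%N -> N%:R <= g -> M%:R + g <= (7 * N)%:R ->
  0 < T -> 2 * T <= N%:R ->
  \sum_(i < M) \sum_(i' < M)
    (#|[set w : 'I_U.+1 * 'I_U.+1 |
      `|w.1%:R * (i%:R + g) - w.2%:R * (i'%:R + g)| < T]|)%:R <=
  9 * N%:R * U%:R + 9 * N%:R ^+ 2 +
    36 * (Num.truncn (4 * T)).+1%:R * N%:R * U%:R * \sum_(v < N) (v.+1)%:R^-1 :> R.
Proof.
move=> N0 MN Ng MgN T0 TN.
have N0' : 0 < N%:R :> R by rewrite ltr0n.
have MN' : M%:R <= 3 * N%:R :> R by rewrite -natrM ler_nat.
pose W : R := 1 + U%:R / N%:R.
pose D (i i' : 'I_M) v := near_denom (i%:R + g) (i'%:R + g) (2 * T) v.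
apply: (@le_trans _ _ (\sum_(i < M) \sum_(i' < M)
  (W + U%:R * \sum_(v < N | D i i' v.+1) (v.+1)%:R^-1))).
  apply: ler_sum => i _; apply: ler_sum => i' _; apply: card_strip_le => //.
  - by rewrite (le_trans Ng) // lerDr.
  - by rewrite (le_trans Ng) // lerDr.
  - by rewrite (le_trans _ MgN) // lerD2r ler_nat ltnW.
under eq_bigr => i _ do rewrite big_split /= sumr_const card_ord -mulr_sumr.
rewrite big_split /= sumr_const card_ord -mulr_sumr.
apply: lerD.
  rewrite -(mulr_natr (W *+ M)) -(mulr_natr W) /W.
  have -> : 9 * N%:R * U%:R + 9 * N%:R ^+ 2 = (1 + U%:R / N%:R) * (3 * N%:R) * (3 * N%:R) :> R.
    by field; rewrite gt_eqF.
  have W0 : 0 <= 1 + U%:R / N%:R :> R by rewrite addr_ge0 // divr_ge0.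
  by rewrite ler_pM ?mulr_ge0 // ler_wpM2l.
rewrite -!mulrA [X in _ <= X]mulrA [X in _ <= X]mulrA mulrCA -!mulrA.
rewrite ler_wpM2l //.
have -> : \sum_(i < M) \sum_(i' < M) \sum_(v < N | D i i' v.+1) (v.+1)%:R^-1 =
  \sum_(v < N) (v.+1)%:R^-1 * (#|[set p : 'I_M * 'I_M | D p.1 p.2 v.+1]|)%:R :> R.
  rewrite pair_big /= (exchange_big_dep xpredT) //=; apply: eq_bigr => v _.
  by rewrite mulr_natr -sumr_const; apply: eq_bigl => p; rewrite inE.
rewrite !mulr_sumr; apply: ler_sum => v _.
rewrite mulrC !mulrA ler_wpM2r ?invr_ge0 //.
have vN : v.+1%:R <= N%:R :> R by rewrite ler_nat.
set K : R := (Num.truncn (4 * T)).+1%:R.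
have K0 : 0 <= K by rewrite /K.
pose V := v.+1.
apply: (@le_trans _ _ ((8 * V).+1 * ((Num.truncn (4 * T)).+1 * (M %/ V).+1))%:R).
  rewrite ler_nat.
  pose A (v' : 'I_(8 * V).+1) := [set p : 'I_M * 'I_M | coprime V v' &&
      (`|V%:R * (p.1%:R + g) - v'%:R * (p.2%:R + g)| < 2 * T)].
  have -> : [set p : 'I_M * 'I_M | D p.1 p.2 V] = \bigcup_v' A v'.
    apply/setP => p; rewrite inE /D /near_denom /=; apply/existsP/bigcupP.
      by case=> v' h; exists v'; rewrite // inE.
    by case=> v' _; rewrite inE => h; exists v'.
  apply: (@leq_trans (\sum_v' #|A v'|)%N).
    elim/big_ind2: _ => [|m B n C hB hC|//]; first by rewrite cards0.
    by rewrite (leq_trans (leq_card_setU _ _)) // leq_add.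
  apply: (@leq_trans (\sum_(v' < (8 * V).+1) (Num.truncn (4 * T)).+1 * (M %/ V).+1)%N); last first.
    by rewrite sum_nat_const card_ord.
  apply: leq_sum => v' _.
  have [cop|ncop] := boolP (coprime V v'); last first.
    by rewrite (_ : A v' = finset.set0) ?cards0 //; apply/setP => p; rewrite !inE (negbTE ncop).
  have -> : 4 * T = 2 * (2 * T) by ring.
  have -> : A v' = [set p : 'I_M * 'I_M |
      `|V%:R * (p.1%:R + g) - v'%:R * (p.2%:R + g)| < 2 * T].
    by apply/setP => p; rewrite !inE cop.
  by apply: card_coprime_near => //; lra.
rewrite !natrM -/K.
rewrite -/V in vN; have V1 : 1 <= V%:R :> R by rewrite ler1n.
have h1 : (8 * V).+1%:R <= 9 * V%:R :> R by rewrite -natr1 natrM; lra.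
have h2 : (M %/ V).+1%:R * V%:R <= 4 * N%:R :> R.
  have : (M %/ V)%:R * V%:R <= M%:R :> R by rewrite -natrM ler_nat leq_divM.
  by rewrite -natr1 mulrDl mul1r; lra.
have q0 : 0 <= (M %/ V).+1%:R :> R by [].
move: h1 h2 q0; set a := (8 * V).+1%:R; set b := (M %/ V).+1%:R => h1 h2 q0.
apply: (@le_trans _ _ (9 * V%:R * (K * b))).
  by rewrite ler_wpM2r // mulr_ge0.
have -> : 9 * V%:R * (K * b) = 9 * K * (b * V%:R) by ring.
have -> : 36 * K * N%:R = 9 * K * (4 * N%:R) by ring.
by rewrite ler_wpM2l // mulr_ge0.
Qed.

(** Each dyadic block of the harmonic sum contributes at most 1. *)
Lemma harmonic_pow2_le (R : realFieldType) (j : nat) :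
  \sum_(v < 2 ^ j) (v.+1)%:R^-1 <= j.+1%:R :> R.
Proof.
elim: j => [|j IHj]; first by rewrite expn0 big_ord1 invr1.
rewrite expnS mul2n -addnn big_split_ord /= -[j.+2%:R]natr1 lerD //.
apply: (@le_trans _ _ (\sum_(i < 2 ^ j) ((2 ^ j)%:R)^-1)).
  apply: ler_sum => i _; rewrite lef_pV2 ?posrE ?ltr0n ?expn_gt0 // ler_nat; lia.
by rewrite sumr_const card_ord -[_ *+ _]mulr_natr mulVf // pnatr_eq0 expn_eq0.
Qed.

(** * A nonnegative trigonometric kernel *)

Local Open Scope complex_scope.

Definition cis (R : realType) (t : R) : R[i] := cos t +i* sin t.

Lemma cisX (R : realType) (t : R) n : cis t ^+ n = cis (n%:R * t).
Proof.
elim: n => [|n IHn]; first by rewrite expr0 mul0r /cis cos0 sin0.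
rewrite exprS IHn -natr1 mulrDl mul1r addrC /cis cosD sinD.
by apply/eqP; rewrite eq_complex /=; apply/andP; split; apply/eqP; ring.
Qed.

Definition sqnormc (R : realType) (z : R[i]) : R :=
  complex.Re z ^+ 2 + complex.Im z ^+ 2.

Lemma sqnormcM (R : realType) : {morph @sqnormc R : x y / x * y}.
Proof. by move=> [a b] [c d]; rewrite /sqnormc /=; ring. Qed.

Lemma sqnormcX (R : realType) (z : R[i]) n : sqnormc (z ^+ n) = sqnormc z ^+ n.
Proof.
elim: n => [|n IHn]; first by rewrite !expr0 /sqnormc /=; ring.
by rewrite !exprS sqnormcM IHn.
Qed.

Lemma sum_complex (R : realType) n (x y : nat -> R) :
  \sum_(i < n) (x i +i* y i) = (\sum_(i < n) x i) +i* (\sum_(i < n) y i).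
Proof.
elim: n => [|n IHn]; first by rewrite !big_ord0.
by rewrite !big_ord_recr /= IHn.
Qed.

(** Groups the square by diagonals. Since [f] vanishes outside the range, every diagonal may be
    summed over the full length [n]. *)
Lemma sum_sym_split (R : realType) n (f : nat -> nat -> R) :
  (forall i j, f i j = f j i) -> (forall i j, (n <= j)%N -> f i j = 0) ->
  \sum_(i < n) \sum_(j < n) f i j =
  \sum_(i < n) f i i + 2 * \sum_(h < n) \sum_(i < n) f i (i + h.+1)%N.
Proof.
move=> fC f0.
have split m : \sum_(i < m) \sum_(j < m) f i j =
    \sum_(i < m) f i i + 2 * \sum_(i < m) \sum_(i.+1 <= j < m) f i j.
  elim: m => [|m IHm]; first by rewrite !big_ord0 mulr0 addr0.
  rewrite !big_ord_recr /= big_geq // addr0.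
  under eq_bigr do rewrite big_ord_recr /=.
  under [X in _ = _ + 2 * X]eq_bigr => i _ do rewrite big_nat_recr //=.
  rewrite !big_split /= IHm.
  under [X in _ + (X + _) = _]eq_bigr do rewrite fC.
  ring.
rewrite split exchange_big /=; congr (_ + 2 * _); apply: eq_bigr => i _.
rewrite -{1}[i.+1]add0n big_addn.
rewrite -(big_mkord xpredT (fun h => f i (i + h.+1)%N)).
rewrite [in RHS](@big_cat_nat _ _ _ (n - i.+1)) ?leq_subr //=.
rewrite [X in _ = _ + X]big_nat_cond [X in _ = _ + X]big1 ?addr0.
  by apply: eq_bigr => h _; rewrite addnC addnS.
by move=> h /andP[/andP[h1 _] _]; apply: f0; lia.
Qed.

(** The Fourier coefficients of the squared modulus of [p] on the unit circle are the
    autocorrelations of the coefficients of [p]. *)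
Lemma sqnormc_horner_cis (R : realType) (p : {poly R}) n (t : R) : (size p <= n)%N ->
  sqnormc ((map_poly (real_complex R) p).[cis t]) =
  \sum_(i < n) p`_i ^+ 2 +
    2 * \sum_(h < n) (\sum_(i < n) p`_i * p`_(i + h.+1)) * cos (h.+1%:R * t).
Proof.
move=> pn.
rewrite (@horner_coef_wide _ n) ?size_map_poly //.
have -> : \sum_(i < n) (map_poly (real_complex R) p)`_i * cis t ^+ i =
  \sum_(i < n) ((p`_i * cos (i%:R * t)) +i* (p`_i * sin (i%:R * t))).
  apply: eq_bigr => i _; rewrite cisX coef_map /cis /=.
  by apply/eqP; rewrite eq_complex /=; apply/andP; split; apply/eqP; ring.
rewrite (sum_complex _ (fun i => p`_i * cos (i%:R * t)) (fun i => p`_i * sin (i%:R * t))).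
pose f i j := p`_i * p`_j * cos (i%:R * t - j%:R * t).
have -> : forall x y, sqnormc (x +i* y) = x * x + y * y :> R by [].
transitivity (\sum_(i < n) \sum_(j < n) f i j).
  rewrite !mulr_suml -big_split /=; apply: eq_bigr => i _.
  rewrite !mulr_sumr -big_split /=; apply: eq_bigr => j _.
  by rewrite /f cosB; ring.
rewrite (@sum_sym_split _ n f).
- congr (_ + 2 * _); first by apply: eq_bigr => i _; rewrite /f subrr cos0 mulr1 expr2.
  apply: eq_bigr => h _; rewrite mulr_suml; apply: eq_bigr => i _.
  by rewrite /f -cosN natrD; congr (_ * cos _); ring.
- by move=> i j; rewrite /f -cosN opprB [p`_i * _]mulrC.
- by move=> i j nj; rewrite /f (@nth_default _ 0 p j) ?mulr0 ?mul0r // (leq_trans pn).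
Qed.

(** The kernel is the squared modulus of [(1 + z + ... + z ^ (H - 1)) ^ k] at [z = cis t], a power
    of a Fejer kernel up to scaling, with mean [c0]. The three claims bound its mean from below, its
    other coefficients by the mean, and its values away from [t = 0]. *)
Lemma kernel_exists (R : realType) (H k : nat) : (0 < H)%N -> (0 < k)%N ->
  exists (c0 : R) (c : nat -> R),
  [/\ H%:R ^+ (2 * k) <= (k * H)%:R * c0,
      forall h, 0 <= c h <= c0 &
      forall t, (c0 + 2 * \sum_(h < k * H) c h * cos (h.+1%:R * t)) *
                (2 - 2 * cos t) ^+ k <= 4 ^+ k].
Proof.
move=> H0 k0.
pose d : {poly R} := \sum_(i < H) 'X^i.
pose p := d ^+ k; pose n := (k * H)%N.
have size_d : (size d <= H)%N.
  rewrite (leq_trans (size_sum _ _ _)) //; apply/bigmax_leqP => i _.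
  by rewrite size_polyXn.
have size_p : (size p <= n)%N.
  rewrite (leq_trans (size_poly_exp_leq _ _)) // /n.
  have : ((size d).-1 * k <= H.-1 * k)%N by rewrite leq_mul2r; apply/orP; right; lia.
  by case: (H) H0 => // H' _; nia.
have p_ge0 i : 0 <= p`_i.
  rewrite /p; elim: (k) i => [|m IHm] i; first by rewrite expr0 coefC; case: ifP.
  rewrite exprS coefM; apply: sumr_ge0 => j _; rewrite mulr_ge0 // coef_sum.
  by apply: sumr_ge0 => l _; rewrite coefXn.
exists (\sum_(i < n) p`_i ^+ 2), (fun h => \sum_(i < n) p`_i * p`_(i + h.+1)).
split.
- have -> : H%:R ^+ (2 * k) = (\sum_(i < n) p`_i) ^+ 2.
    have -> : \sum_(i < n) p`_i = p.[1].
      by rewrite (@horner_coef_wide _ n) //; apply: eq_bigr => i _; rewrite expr1n mulr1.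
    rewrite horner_exp horner_sum; under eq_bigr do rewrite hornerXn expr1n.
    by rewrite sumr_const card_ord exprM exprAC.
  (* Cauchy-Schwarz for the coefficients of [p] against the constant 1. *)
  have : 0 <= \sum_(i < n) \sum_(j < n) (p`_i - p`_j) ^+ 2.
    by apply: sumr_ge0 => i _; apply: sumr_ge0 => j _; rewrite sqr_ge0.
  have -> : \sum_(i < n) \sum_(j < n) (p`_i - p`_j) ^+ 2 =
    2 * (n%:R * (\sum_(i < n) p`_i ^+ 2) - (\sum_(i < n) p`_i) ^+ 2).
    transitivity (\sum_(i < n) (n%:R * p`_i ^+ 2 + \sum_(j < n) p`_j ^+ 2 +
        (- 2 * \sum_(j < n) p`_j) * p`_i)).
      apply: eq_bigr => i _.
      transitivity (\sum_(j < n) (p`_i ^+ 2 + p`_j ^+ 2 + (- 2 * p`_i) * p`_j)).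
        by apply: eq_bigr => j _; ring.
      rewrite !big_split /= sumr_const card_ord -mulr_sumr -[_ *+ n]mulr_natr; ring.
    rewrite !big_split /= sumr_const card_ord -!mulr_sumr -[_ *+ n]mulr_natr; ring.
  by rewrite pmulr_rge0 // subr_ge0.
- move=> h; apply/andP; split; first by apply: sumr_ge0 => i _; rewrite mulr_ge0.
  apply: (@le_trans _ _ (\sum_(i < n) (p`_i ^+ 2 + p`_(i + h.+1) ^+ 2) / 2)).
    apply: ler_sum => i _; have := sqr_ge0 (p`_i - p`_(i + h.+1)); lra.
  rewrite -mulr_suml big_split /=.
  suff : \sum_(i < n) p`_(i + h.+1) ^+ 2 <= \sum_(i < n) p`_i ^+ 2 by lra.
  rewrite -(big_mkord xpredT (fun i => p`_(i + h.+1) ^+ 2)) -(big_mkord xpredT (fun i => p`_i ^+ 2)).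
  have -> : \sum_(0 <= i < n) p`_(i + h.+1) ^+ 2 = \sum_(h.+1 <= i < n + h.+1) p`_i ^+ 2.
    by rewrite -{2}[h.+1]add0n big_addn addnK.
  have tail m : (n <= m)%N -> \sum_(m <= i < n + h.+1) p`_i ^+ 2 = 0.
    move=> nm; rewrite big_nat_cond big1 // => i /andP[/andP[mi _] _].
    by rewrite nth_default ?expr0n // (leq_trans size_p) // (leq_trans nm).
  have [hn|hn] := leqP n h.+1.
    by rewrite tail //; apply: sumr_ge0 => i _; rewrite sqr_ge0.
  rewrite (@big_cat_nat _ _ _ n) ?leq_addr 1?ltnW //= tail // addr0.
  rewrite [leRHS](@big_cat_nat _ _ _ h.+1) 1?ltnW //= lerDr.
  by apply: sumr_ge0 => i _; rewrite sqr_ge0.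
- move=> t; rewrite -sqnormc_horner_cis //.
  rewrite rmorphXn horner_exp sqnormcX -exprMn.
  (* The factor is the squared modulus of [z - 1], and [z - 1] times the geometric sum is
     [z ^ H - 1], of squared modulus at most 4. *)
  have -> : 2 - 2 * cos t = sqnormc (cis t - 1).
    by rewrite /sqnormc /=; have := cos2Dsin2 t; lra.
  rewrite -sqnormcM /d rmorph_sum /= horner_sum.
  under eq_bigr do rewrite map_polyXn hornerXn.
  rewrite mulrC -subrX1 cisX.
  rewrite lerXn2r ?nnegrE //; first by rewrite addr_ge0 ?sqr_ge0.
  rewrite /sqnormc /=; have := cos2Dsin2 (H%:R * t); have := cos_geN1 (H%:R * t); lra.
Qed.

Local Close Scope complex_scope.

Lemma cosD2pi_int (R : realType) (x : R) (z : int) : cos (x + 2 * pi * z%:~R) = cos x.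
Proof.
have natcase n (y : R) : cos (y + 2 * pi * n%:R) = cos y.
  elim: n => [|n IHn] in y *; first by rewrite mulr0 addr0.
  have -> : y + 2 * pi * n.+1%:R = y + 2 * pi * n%:R + pi *+ 2.
    by rewrite -natr1 mulr2n; ring.
  by rewrite cosD2pi IHn.
case: z => n; first exact: natcase.
rewrite NegzE -[LHS](natcase n.+1); congr cos.
by rewrite mulrNz -pmulrn; ring.
Qed.

(** Let [s = 2 pi y]. For [s <= pi / 4] the mean value theorem gives [sin s = s cos xi] with
    [cos xi ^ 2 >= 1 / 2], and the square of [sin s] is at most [2 - 2 cos s]. Beyond that,
    [cos s < 3 / 4] while [y ^ 2 <= 1 / 4]. *)
Lemma sqr_le_2B2cos (R : realType) (y : R) : `|y| <= 1 / 2 ->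
  y ^+ 2 <= 2 - 2 * cos (2 * pi * y).
Proof.
wlog y0 : y / 0 <= y => [hw|].
  have [|y0] := leP 0 y; first exact: hw.
  by have := hw (- y); rewrite sqrrN normrN mulrN cosN; apply; lra.
rewrite ger0_norm // => y1.
have pi2 := pi_ge2 R.
have k2 : cos (pi / 4) ^+ 2 = 1 / 2 :> R.
  have := cos_pihalf R; rewrite (_ : pi / 2 = pi / 4 + pi / 4); last by field.
  by rewrite cosD; have := cos2Dsin2 (pi / 4 : R); lra.
have k0 : 0 <= cos (pi / 4) :> R by apply: cos_ge0_pihalf; apply/andP; split; lra.
have k34 : cos (pi / 4) <= 3 / 4 :> R by nra.
have mono t : 0 <= t <= pi / 4 -> cos (pi / 4) <= cos t :> R.
  move=> /andP[t0]; rewrite le_eqVlt => /orP[/eqP -> //|tp].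
  by rewrite ltW // ltr_cos // in_itv /=; apply/andP; split; lra.
have y01 : 0 <= 2 * pi * y by rewrite mulr_ge0 //; lra.
have [ty|ty] := leP (2 * pi * y) (pi / 4).
  have [xi] := @MVT_segment R sin cos 0 (2 * pi * y) y01 (fun x _ => is_derive_sin x)
    (@continuous_subspaceT _ _ _ _ (@continuous_sin R)).
  rewrite in_itv /= => /andP[x0 x1]; rewrite sin0 subr0 subr0 => sinE.
  have kxi : cos (pi / 4) <= cos xi by apply: mono; apply/andP; split; lra.
  have kxi2 : 1 / 2 <= cos xi ^+ 2 by rewrite -k2 lerXn2r ?nnegrE //; lra.
  have c0 : 0 <= cos (2 * pi * y) by apply: (le_trans k0); apply: mono; apply/andP; split; lra.
  have c1 := cos_le1 (2 * pi * y).
  have s2 : sin (2 * pi * y) ^+ 2 = 1 - cos (2 * pi * y) ^+ 2.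
    by have := cos2Dsin2 (2 * pi * y); lra.
  have sge : y ^+ 2 <= sin (2 * pi * y) ^+ 2.
    rewrite sinE exprMn.
    have : 1 / 2 * (2 * pi * y) ^+ 2 <= cos xi ^+ 2 * (2 * pi * y) ^+ 2.
      by rewrite ler_wpM2r ?sqr_ge0.
    apply: le_trans; rewrite !exprMn.
    have : 4 <= pi ^+ 2 :> R by nra.
    by have := sqr_ge0 y; nra.
  apply: (le_trans sge); rewrite s2; nra.
have ct : cos (2 * pi * y) < cos (pi / 4).
  by rewrite ltr_cos // in_itv /=; apply/andP; split; nra.
by nra.
Qed.

Lemma sqr_le_2B2cos_dist (R : realType) (x e : R) : 0 <= e ->
  (forall z : int, e <= `|x - z%:~R|) -> e ^+ 2 <= 2 - 2 * cos (2 * pi * x).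
Proof.
move=> e0 h; pose z := Num.floor (x + 1 / 2).
have := floor_itv (x + 1 / 2); rewrite -/z intrD => /andP[z1 z2].
rewrite (_ : 2 * pi * x = 2 * pi * (x - z%:~R) + 2 * pi * z%:~R); last by ring.
rewrite cosD2pi_int; apply: le_trans (sqr_le_2B2cos _); last first.
  by rewrite ler_norml; lra.
by rewrite -[leRHS]real_normK ?num_real // lerXn2r ?nnegrE.
Qed.

(** * Frequencies in a common unit cell *)

Lemma is_derive_bigsum (R : realType) (J : Type) (r : seq J) (g : J -> R -> R)
    (dg : J -> R) (t : R) : (forall i, is_derive t (1 : R) (g i) (dg i)) ->
  is_derive t (1 : R) (fun u => \sum_(i <- r) g i u) (\sum_(i <- r) dg i).
Proof.
move=> h; elim: r => [|i r IHr].
  rewrite big_nil (_ : (fun u => _) = cst 0); first exact: is_derive_cst.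
  by apply/funext => u; rewrite big_nil.
rewrite big_cons (_ : (fun u => _) = g i + (fun u => \sum_(i <- r) g i u)).
  exact: is_deriveD.
by apply/funext => u; rewrite big_cons.
Qed.

Definition distn (k l : nat) : nat := ((k - l) + (l - k))%N.

Lemma sum_inv_sqr_le (R : realFieldType) n :
  \sum_(m < n) (1 + m%:R ^+ 2)^-1 <= 6 :> R.
Proof.
(* The remainder [6 / (n + 1)] strengthens the claim so that the induction telescopes. *)
suff : \sum_(m < n) (1 + m%:R ^+ 2)^-1 <= 6 - 6 / n.+1%:R :> R.
  by move=> /le_trans; apply; rewrite gerBl divr_ge0.
elim: n => [|n IHn]; first by rewrite big_ord0 divr1 subrr.
rewrite big_ord_recr /=; apply: (le_trans (lerD IHn (lexx _))).
have n0 : 0 <= n%:R :> R by [].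
rewrite -![_.+1%:R]natr1.
have E : 6 / ((n%:R + 1) * (n%:R + 1 + 1)) = 6 / (n%:R + 1) - 6 / (n%:R + 1 + 1) :> R.
  by field; apply/andP; split; apply: lt0r_neq0; lra.
suff : (1 + n%:R ^+ 2)^-1 <= 6 / ((n%:R + 1) * (n%:R + 1 + 1)) :> R by lra.
rewrite -[leLHS]mul1r ler_pdivrMr; last by nra.
by rewrite mulrAC ler_pdivlMr; nra.
Qed.

Lemma sum_inv_sqr_distn_le (R : realFieldType) n k : (k < n)%N ->
  \sum_(l < n) (1 + (distn k l)%:R ^+ 2)^-1 <= 12 :> R.
Proof.
move=> kn; rewrite -(big_mkord xpredT (fun l => (1 + (distn k l)%:R ^+ 2)^-1)).
rewrite (@big_cat_nat _ _ _ k) ?(ltnW kn) //=.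
have -> : 12 = 6 + 6 :> R by ring.
apply: lerD.
  rewrite big_nat_rev /= add0n; apply: (le_trans _ (sum_inv_sqr_le _ k.+1)).
  rewrite big_ord_recl big_mkord -[leLHS]add0r; apply: lerD; first by rewrite invr_ge0 addr_ge0 ?sqr_ge0.
  apply: ler_sum => l _; rewrite le_eqVlt; apply/orP; left; apply/eqP; congr (1 + _%:R ^+ 2)^-1.
  by rewrite /distn /= /bump /=; have := ltn_ord l; lia.
rewrite -{1}[k]add0n big_addn big_mkord; apply: (le_trans _ (sum_inv_sqr_le _ (n - k))).
apply: ler_sum => l _; rewrite le_eqVlt; apply/orP; left; apply/eqP; congr (1 + _%:R ^+ 2)^-1.
by rewrite /distn; lia.
Qed.

Lemma sum_by_cell (R : realFieldType) (I : finType) (f : I -> nat) (B : nat) (h : nat -> R) :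
  (forall i, f i < B)%N ->
  \sum_i h (f i) = \sum_(k < B) (#|[set i | f i == k]|)%:R * h k.
Proof.
move=> fB; rewrite (partition_big (fun i => Ordinal (fB i)) xpredT) //=.
apply: eq_bigr => k _.
rewrite (eq_bigr (fun=> h k)) => [|i /eqP <- //].
rewrite -sum1_card natr_sum mulr_suml; apply: eq_big => [i|i _]; last by rewrite mul1r.
by rewrite inE -val_eqE.
Qed.

(** A Schur test: with [n k] points in cell [k], the left side is a quadratic form in [n] whose
    matrix has row sums at most 12, and the sum of the [n k ^ 2] counts the pairs sharing a cell. *)
Lemma sum_cells_le (R : realFieldType) (I : finType) (f : I -> nat) :
  \sum_(i : I) \sum_(j : I) (1 + (distn (f i) (f j))%:R ^+ 2)^-1 <=
    12 * (#|[set p : I * I | f p.1 == f p.2]|)%:R :> R.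
Proof.
pose B := (\max_i f i).+1.
have fB i : (f i < B)%N by rewrite ltnS leq_bigmax.
pose n k : R := (#|[set i | f i == k]|)%:R.
pose w k l : R := (1 + (distn k l)%:R ^+ 2)^-1.
have w0 k l : 0 <= w k l by rewrite invr_ge0 addr_ge0 ?sqr_ge0.
have wC k l : w k l = w l k by rewrite /w /distn addnC.
have -> : \sum_(i : I) \sum_(j : I) (1 + (distn (f i) (f j))%:R ^+ 2)^-1 =
    \sum_(k < B) \sum_(l < B) n k * n l * w k l.
  rewrite (sum_by_cell (fun k => \sum_(j : I) w k (f j)) fB); apply: eq_bigr => k _.
  rewrite (sum_by_cell (w k) fB) mulr_sumr; apply: eq_bigr => l _.
  by rewrite mulrA.
have -> : (#|[set p : I * I | f p.1 == f p.2]|)%:R = \sum_(k < B) n k ^+ 2 :> R.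
  rewrite -sum1_card natr_sum.
  transitivity (\sum_(i : I) n (f i)).
    rewrite /n (eq_bigl (fun p : I * I => f p.1 == f p.2)); last by move=> p; rewrite inE.
    rewrite -(pair_big_dep xpredT (fun i j => f i == f j) (fun _ _ => 1)) /=.
    apply: eq_bigr => i _; rewrite -sum1_card natr_sum.
    by apply: eq_bigl => j; rewrite inE eq_sym.
  by rewrite (sum_by_cell n fB); apply: eq_bigr => k _; rewrite expr2.
apply: (@le_trans _ _ (\sum_(k < B) \sum_(l < B) (n k ^+ 2 * w k l / 2 + n l ^+ 2 * w k l / 2))).
  apply: ler_sum => k _; apply: ler_sum => l _.
  have := mulr_ge0 (w0 k l) (sqr_ge0 (n k - n l)); lra.
under eq_bigr do rewrite big_split /=.
rewrite big_split /= [X in _ + X]exchange_big /=.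
under [X in _ + X]eq_bigr => k _ do under eq_bigr => l _ do rewrite wC.
rewrite -big_split /= mulr_sumr; apply: ler_sum => k _.
rewrite -big_split /= (eq_bigr (fun l : 'I_B => n k ^+ 2 * w k l)); last by move=> l _; lra.
rewrite -mulr_sumr mulrC ler_wpM2r ?sqr_ge0 //.
exact: sum_inv_sqr_distn_le.
Qed.

Lemma distn_truncn (R : archiRealFieldType) (x y : R) : 0 <= x -> 0 <= y ->
  (1 + (distn (Num.truncn x) (Num.truncn y))%:R ^+ 2 : R) <= 3 * (1 + (x - y) ^+ 2).
Proof.
move=> /truncn_itv/andP[x1 x2] /truncn_itv/andP[y1 y2].
set k := Num.truncn x in x1 x2 *; set l := Num.truncn y in y1 y2 *.
rewrite -natr1 in x2; rewrite -natr1 in y2.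
have aux d : 0 <= d -> d <= `|x - y| + 1 -> 1 + d ^+ 2 <= 3 * (1 + (x - y) ^+ 2).
  move=> d0 dle.
  have : d ^+ 2 <= (`|x - y| + 1) ^+ 2 by rewrite lerXn2r ?nnegrE // addr_ge0.
  rewrite -(real_normK (num_real (x - y))); have := sqr_ge0 `|x - y|; have := sqr_ge0 (`|x - y| - 1); lra.
have [kl|/ltnW lk] := leqP k l; apply: aux => //.
- rewrite /distn (eqP kl) add0n natrB // distrC; have := ler_norm (y - x); lra.
- rewrite /distn (eqP lk) addn0 natrB //; have := ler_norm (x - y); lra.
Qed.

Definition gap_index (L N : nat) : finType := ('I_L * ('I_N * 'I_N))%type.

(* The triple (h, d, n) stands for the frequency (h + 1) (x_(m' + d + 1) - x_m')
   with m' = N + n + 1, where x is the quadratic sequence. *)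
Definition gap_freq (R : realType) (a b : R) (L N : nat) (p : gap_index L N) : R :=
  p.1.+1%:R * (p.2.1.+1%:R * (a * (2 * (N + p.2.2.+1) + p.2.1.+1)%:R + b)).

(** Brings the frequency to the form [a u (s + g)] with integers [u], [s] and a fixed shift [g], as
    required for counting near coincidences of products. *)
Lemma gap_freqE (R : realType) (a b : R) (L N : nat) (p : gap_index L N) : a != 0 ->
  gap_freq a b p = a * ((p.1.+1 * p.2.1.+1)%:R *
    ((2 * p.2.2 + p.2.1)%:R + ((2 * N + 3)%:R + b / a))).
Proof. by move=> a0; rewrite /gap_freq !(natrD, natrM) -!natr1; field. Qed.

(** A triple is recovered from [s = 2 n + d], [u = (h + 1) (d + 1)] and the rank of [d + 1] among
    the divisors of [u]. Two frequencies in one unit cell differ by less than 1, so the products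
    [u (s + g)] differ by less than [a^-1]. *)
Lemma card_same_cell (R : realType) (a b : R) (L N D : nat) : 0 < a ->
  (forall p : gap_index L N, 0 <= gap_freq a b p) ->
  (forall u, (0 < u <= L * N)%N -> (size (divisors u) <= D.+1)%N) ->
  (#|[set p : gap_index L N * gap_index L N |
      Num.truncn (gap_freq a b p.1) == Num.truncn (gap_freq a b p.2)]| <=
   (\sum_(i < 3 * N) \sum_(i' < 3 * N)
     #|[set w : 'I_(L * N).+1 * 'I_(L * N).+1 |
       (`|w.1%:R * (i%:R + ((2 * N + 3)%:R + b / a)) -
         w.2%:R * (i'%:R + ((2 * N + 3)%:R + b / a))| < a^-1)%R]|) * (D.+1 * D.+1))%N.
Proof.
move=> a0 x0 hD; set g := (2 * N + 3)%:R + b / a.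
pose M := (3 * N)%N; pose U := (L * N)%N.
pose near (z : ('I_M * 'I_M) * ('I_U.+1 * 'I_U.+1)) :=
  `|z.2.1%:R * (z.1.1%:R + g) - z.2.2%:R * (z.1.2%:R + g)| < a^-1.
have cardY : (\sum_(i < M) \sum_(i' < M) #|[set w : 'I_U.+1 * 'I_U.+1 |
       (`|w.1%:R * (i%:R + g) - w.2%:R * (i'%:R + g)| < a^-1)%R]|)%N = #|[set z | near z]|.
  rewrite pair_big /= -sum1_card (eq_bigl near); last by move=> z; rewrite inE.
  rewrite -(pair_big_dep xpredT (fun i w => near (i, w)) (fun _ _ => 1%N)) /=.
  by apply: eq_bigr => i _; rewrite -sum1_card; apply: eq_bigl => w; rewrite inE.
have -> : (D.+1 * D.+1)%N = #|[set: 'I_D.+1 * 'I_D.+1]%SET|.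
  by rewrite cardsT card_prod !card_ord.
rewrite cardY -cardsX.
have lt_s (d n : 'I_N) : (2 * n + d < M)%N.
  by rewrite /M; have := ltn_ord d; have := ltn_ord n; lia.
have lt_u (h : 'I_L) (d : 'I_N) : (h.+1 * d.+1 < U.+1)%N.
  by rewrite ltnS leq_mul.
pose s (p : gap_index L N) := Ordinal (lt_s p.2.1 p.2.2).
pose u (p : gap_index L N) := Ordinal (lt_u p.1 p.2.1).
pose rk (p : gap_index L N) : 'I_D.+1 := inord (index p.2.1.+1 (divisors (u p))).
pose f (p : gap_index L N * gap_index L N) :=
  (((s p.1, s p.2), (u p.1, u p.2)), (rk p.1, rk p.2)).
have inj p p' : s p = s p' -> u p = u p' -> rk p = rk p' -> p = p'.
  case: p p' => h [d n] [h' [d' n']] /(congr1 val) /= Es /(congr1 val) /= Eu.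
  rewrite /rk /= Eu => /(congr1 val).
  have u0 : (0 < h'.+1 * d'.+1)%N by [].
  have dd : d.+1 \in divisors (h'.+1 * d'.+1) by rewrite -dvdn_divisors // -Eu dvdn_mull.
  have dd' : d'.+1 \in divisors (h'.+1 * d'.+1) by rewrite -dvdn_divisors // dvdn_mull.
  have hD' : (size (divisors (h'.+1 * d'.+1)) <= D.+1)%N.
    by apply: hD; rewrite u0 leq_mul.
  rewrite /= !inordK; first last.
  - by rewrite (leq_trans _ hD') // index_mem.
  - by rewrite (leq_trans _ hD') // index_mem.
  move=> /(index_inj 0 dd dd') [Ed].
  have -> : d = d' by apply: val_inj.
  have -> : h = h'.
    apply: val_inj => /=; move/eqP: Eu; rewrite Ed eqn_pmul2r // => /eqP; lia.
  by have -> : n = n' by apply: val_inj => /=; rewrite Ed in Es; lia.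
rewrite -(card_in_imset (f := f)).
  apply: subset_leq_card; apply/fintype.subsetP => _ /imsetP[p pX ->].
  rewrite !inE /= andbT; rewrite inE in pX.
  move/eqP: pX => /(truncn_eq_lt1 (x0 _) (x0 _)).
  rewrite !gap_freqE ?gt_eqF // -mulrBr normrM (gtr0_norm a0).
  by rewrite mulrC -ltr_pdivlMr // div1r.
move=> [p1 p2] [q1 q2] _ _ E; congr pair; apply: inj.
- exact: (congr1 (fun z => z.1.1.1) E).
- exact: (congr1 (fun z => z.1.2.1) E).
- exact: (congr1 (fun z => z.2.1) E).
- exact: (congr1 (fun z => z.1.1.2) E).
- exact: (congr1 (fun z => z.1.2.2) E).
- exact: (congr1 (fun z => z.2.2) E).
Qed.

(** Up to constants [N * (L * N)] is [q ^ (4 r - 4)], the harmonic sum costs one factor [q], and the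
    divisor bound costs one more for each of the two triples. Compared with [N ^ 4 = q ^ (4 r)] this
    saves a factor [q]. *)
Lemma card_same_cell_le (R : realType) (a b : R) (r : nat) : 0 < a -> (2 < r)%N ->
  exists2 C : R, 0 <= C & exists j0 : nat, forall j, (j0 <= j)%N ->
    let q := (2 ^ j)%N in let L := (r * q ^ (2 * r - 4))%N in let N := (q ^ r)%N in
    (forall p : gap_index L N, 0 <= gap_freq a b p) /\
    (#|[set p : gap_index L N * gap_index L N |
      Num.truncn (gap_freq a b p.1) == Num.truncn (gap_freq a b p.2)]|)%:R <=
    C * q%:R ^+ (4 * r - 1).
Proof.
move=> a0 r2.
have r3 : (0 < 3 * r)%N by lia.
have r0 : (0 < r)%N by lia.
have e1 : (2 * r - 4 + r = 3 * r - 4)%N by lia.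
have e2 : (4 * r - 1 = (2 * r - 4 + (r + r)).+3)%N by lia.
have [Cd hCd] := size_divisors_le r3.
pose T' := (Num.truncn (4 * a^-1)).+1.
(* Once [N] reaches this bound, the shift [g = 2 N + 3 + b / a] lies between [N] and [4 N], and
   [2 / a <= N]. *)
pose K := `|b / a| + 3 + 2 * a^-1.
have ia0 : 0 < a^-1 by rewrite invr_gt0.
exists ((54 * T' * r ^ 2 * (Cd * r).+1 ^ 2)%N%:R); first by [].
exists (Num.truncn K).+1 => j j0j q L N.
have q0 : (0 < q)%N by rewrite expn_gt0.
have jq : (j < q)%N by rewrite ltn_expl.
have NE : N = (2 ^ (r * j))%N by rewrite /N /q -expnM mulnC.
have qN : (q <= N)%N by rewrite /N -{1}(expn1 q) leq_pexp2l //; lia.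
have N0 : (0 < N)%N by rewrite expn_gt0 q0.
have L0 : (0 < L)%N by rewrite muln_gt0 expn_gt0 q0; lia.
have KN : K <= N%:R.
  apply: (@le_trans _ _ (j%:R)); last by rewrite ler_nat (leq_trans (ltnW jq)).
  by rewrite (le_trans (ltW (truncnS_gt K))) // ler_nat.
have N1 : 1 <= N%:R :> R by rewrite ler1n.
set g := (2 * N + 3)%:R + b / a.
have := ler_norm (b / a); have := ler_norm (- (b / a)); rewrite normrN => bn bp.
have gE : g = 2 * N%:R + 3 + b / a by rewrite /g natrD natrM.
have Ng : N%:R <= g by rewrite gE; move: KN; rewrite /K; lra.
have Ng7 : (3 * N)%:R + g <= (7 * N)%:R.
  by rewrite gE !natrM; move: KN; rewrite /K; lra.
have TN : 2 * a^-1 <= N%:R by move: KN; rewrite /K; have := normr_ge0 (b / a); lra.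
have x0 (p : gap_index L N) : 0 <= gap_freq a b p.
  rewrite gap_freqE ?gt_eqF // -/g; apply: mulr_ge0; first exact: ltW.
  apply: mulr_ge0 => //; apply: addr_ge0 => //; exact: le_trans Ng.
split=> //.
have LN : (L * N = r * q ^ (3 * r - 4))%N.
  by rewrite /L /N -mulnA -expnD e1.
(* The divisor bound with exponent [3 r] applies: [Cd r q ^ (3 r - 4)] is at most
   [(Cd r q) ^ (3 r)]. *)
have hD u : (0 < u <= L * N)%N -> (size (divisors u) <= (Cd * r * q).+1)%N.
  move=> /andP[u0 uU]; apply: leqW; rewrite -(leq_exp2r _ _ r3).
  apply: (leq_trans (hCd u u0)); apply: (@leq_trans (Cd * (L * N))).
    by rewrite leq_mul2l uU orbT.
  rewrite LN mulnA expnMn leq_mul //.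
    by case: (Cd * r)%N => [//|m]; rewrite -{1}(expn1 m.+1) leq_pexp2l.
  by rewrite leq_pexp2l // leq_subr.
have := card_same_cell a0 x0 hD; rewrite -/g -(ler_nat R) => /le_trans; apply.
rewrite natrM natr_sum; under eq_bigr do rewrite natr_sum.
have := count_near_products (L * N) N0 (leqnn (3 * N)) Ng Ng7 ia0 TN; rewrite -/T'.
set S := \sum_(i < 3 * N) _ => hS.
have T'0 : (0 < T')%N by [].
move: T'0 hS; move: (T') => {}T' T'0 hS.
have hH : \sum_(v < N) (v.+1)%:R^-1 <= (r * q)%:R :> R.
  rewrite NE; apply: (le_trans (harmonic_pow2_le R (r * j))); rewrite ler_nat.
  by apply: (@leq_trans (r * j.+1)); [rewrite mulnS -add1n leq_add2r | rewrite leq_mul2l jq orbT].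
set U := (L * N)%N in hS *.
have NU : (N <= U)%N by rewrite /U leq_pmull.
have hS2 : S <= (54 * T' * (r * q) * (N * U))%N%:R.
  apply: (le_trans hS).
  apply: (@le_trans _ _ ((9 * N * U)%:R + (9 * (N * U))%:R + (36 * T' * (N * U) * (r * q))%:R)).
    apply: lerD; first apply: lerD.
    - by rewrite !natrM.
    - by rewrite -natrX -natrM ler_nat leq_mul2l /= -mulnn leq_mul2l NU orbT.
    - rewrite -!natrM [X in _ <= X%:R](_ : _ = 36 * T' * N * U * (r * q))%N; last by ring.
      by rewrite [X in _ <= X]natrM ler_wpM2l.
  rewrite -!natrD ler_nat.
  have k1 : (0 < T' * (r * q))%N by rewrite !muln_gt0 q0 T'0 (ltn_trans _ r2).
  have -> : (54 * T' * (r * q) * (N * U) = 54 * ((T' * (r * q)) * (N * U)))%N by ring.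
  have -> : (9 * N * U + 9 * (N * U) + 36 * T' * (N * U) * (r * q) =
    18 * (N * U) + 36 * ((T' * (r * q)) * (N * U)))%N by ring.
  move: k1; move: (T' * (r * q))%N (N * U)%N => k m k1.
  have := leq_pmull m k1; move: (k * m)%N => z mz.
  by rewrite (leq_trans (leq_add (leq_mul (leqnn 18) mz) (leqnn _))) // -mulnDl.
apply: (@le_trans _ _ ((54 * T' * (r * q) * (N * U) * ((Cd * r).+1 * q * ((Cd * r).+1 * q)))%N%:R)).
  rewrite [leRHS]natrM; apply: ler_pM => //.
    by apply: sumr_ge0 => i _; apply: sumr_ge0.
  have h : ((Cd * r * q).+1 <= (Cd * r).+1 * q)%N by rewrite mulSn -add1n leq_add2r.
  by rewrite ler_nat; apply: leq_mul.
rewrite -natrX -natrM ler_nat.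
have -> : (q ^ (4 * r - 1) = q * (q * (q * (q ^ (2 * r - 4) * (q ^ r * q ^ r)))))%N.
  by rewrite -!expnD -!expnS e2.
rewrite /U /L /N; move: (q ^ (2 * r - 4))%N (q ^ r)%N (Cd * r).+1 => x y z.
by rewrite leq_eqVlt; apply/orP; left; apply/eqP; ring.
Qed.

(** * Mean squares and exceptional sets *)

Local Open Scope classical_set_scope.

Lemma is_derive_sin_scale (R : realType) (c t : R) :
  is_derive t 1 (fun u => sin (c * u)) (c * cos (c * t)).
Proof.
have h : is_derive t 1 (fun u : R => c * u) c.
  by have := is_deriveZ c (is_derive_id t (1 : R)); rewrite /GRing.scale /= mulr1.
by have := @is_derive1_comp R sin _ t _ _ (is_derive_sin (c * t)) h; rewrite mulrC.
Qed.

Lemma is_derive_cos_scale (R : realType) (c t : R) :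
  is_derive t 1 (fun u => cos (c * u)) (- c * sin (c * t)).
Proof.
have h : is_derive t 1 (fun u : R => c * u) c.
  by have := is_deriveZ c (is_derive_id t (1 : R)); rewrite /GRing.scale /= mulr1.
by have := @is_derive1_comp R cos _ t _ _ (is_derive_cos (c * t)) h; rewrite mulrC mulNr mulrN.
Qed.

(** The window [A ^ 2 - t ^ 2] vanishes at both ends of [[-A, A]], so two integrations by parts,
    encoded in an explicit antiderivative, give decay [1 / c ^ 2]. For [|c| <= 1] the mean value
    theorem gives the bound [2 A ^ 3], which is enough. *)
Lemma cos_window (R : realType) (A c : R) : 0 < A ->
  exists G : R -> R,
    (forall t : R, is_derive t (1 : R) G ((A ^+ 2 - t ^+ 2) * cos (c * t))) /\
    G A - G (- A) <= (4 * A ^+ 3 + 8 * (1 + A)) / (1 + c ^+ 2).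
Proof.
move=> A0.
have bound G : (forall t : R, is_derive t (1 : R) G ((A ^+ 2 - t ^+ 2) * cos (c * t))) ->
    `|c| <= 1 -> G A - G (- A) <= (4 * A ^+ 3 + 8 * (1 + A)) / (1 + c ^+ 2).
  move=> dG c1.
  have AA : - A <= A by lra.
  have Gc : {within `[- A, A], continuous G}.
    apply: continuous_subspaceT => t; apply: differentiable_continuous.
    by apply/derivable1_diffP; case: (dG t).
  have [t] := MVT_segment AA (fun x _ => dG x) Gc.
  rewrite in_itv /= => /andP[t1 t2] ->.
  have c2 : c ^+ 2 <= 1 by rewrite -[c ^+ 2]ger0_norm ?sqr_ge0 // normrX expr_le1.
  rewrite ler_pdivlMr ?ltr_pwDl ?sqr_ge0 //.
  have w0 : 0 <= A ^+ 2 - t ^+ 2 by nra.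
  have h1 : (A ^+ 2 - t ^+ 2) * cos (c * t) <= A ^+ 2.
    by have := cos_le1 (c * t); have := sqr_ge0 t; nra.
  have h2 : (A ^+ 2 - t ^+ 2) * cos (c * t) * (A - - A) <= 2 * A ^+ 3.
    have -> : 2 * A ^+ 3 = A ^+ 2 * (A - - A) by ring.
    by rewrite ler_wpM2r //; lra.
  have A3 : 0 < A ^+ 3 by rewrite exprn_gt0.
  have := sqr_ge0 c.
  by move: h2; set X := _ * (A - - A) => h2 c20; nra.
have [c0|c0] := eqVneq c 0.
  have dG (t : R) : is_derive t (1 : R) (fun t : R => A ^+ 2 * t - t ^+ 3 / 3) ((A ^+ 2 - t ^+ 2) * cos (c * t)).
    rewrite c0 mul0r cos0 mulr1.
    have -> : (fun t : R => A ^+ 2 * t - t ^+ 3 / 3) = (A ^+ 2) \*: id - 3^-1 \*: (id ^+ 3).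
      by apply/funext => u; rewrite !fctE /= /GRing.scale /=; ring.
    eapply is_derive_eq; first by typeclasses eauto.
    by rewrite /GRing.scale /= ; field.
  by eexists; split; [exact: dG | apply: bound => //; rewrite c0 normr0].
pose S u := sin (c * u); pose C u := cos (c * u).
pose G : R -> R := (cst (A ^+ 2) - id ^+ 2) * (c^-1 \*: S) - (2 / c ^+ 2) \*: (id * C) + (2 / c ^+ 3) \*: S.
have dG (t : R) : is_derive t (1 : R) G ((A ^+ 2 - t ^+ 2) * cos (c * t)).
  have dS := is_derive_sin_scale c t; have dC := is_derive_cos_scale c t.
  rewrite /G; eapply is_derive_eq; first by typeclasses eauto.
  rewrite !fctE /= -[c^-1 *: _]/(c^-1 * _) /GRing.scale /= /S /C; field; exact: c0.
exists G; split=> //.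
have [c1|c1] := leP `|c| 1; first exact: bound.
have -> : G A - G (- A) = 4 * (sin (c * A) / c - A * cos (c * A)) / c ^+ 2.
  rewrite /G !fctE /= /GRing.scale /= /S /C mulrN sinN cosN; field; exact: c0.
have c2 : 1 < c ^+ 2 by rewrite -[c ^+ 2]ger0_norm ?sqr_ge0 // normrX exprn_egt1 // ltW.
have s1 : sin (c * A) / c - A * cos (c * A) <= 1 + A.
  apply: lerD.
    apply: le_trans (ler_norm _) _; rewrite normrM normfV ler_pdivrMr ?normr_gt0 //.
    by rewrite mul1r (le_trans _ (ltW c1)) // sin_max.
  by rewrite -mulrN ler_piMr ?(ltW A0) //; have := cos_geN1 (c * A); lra.
rewrite ler_pdivrMr; last lra.
rewrite mulrAC ler_pdivlMr; last by lra.
have A3 : 0 < A ^+ 3 by rewrite exprn_gt0.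
move: s1; set X := sin (c * A) / c - _ => s1.
apply: (@le_trans _ _ (4 * (1 + A) * (1 + c ^+ 2))).
  by rewrite ler_wpM2r ?ler_wpM2l //; lra.
apply: (@le_trans _ _ (8 * (1 + A) * c ^+ 2)); last by rewrite ler_wpM2r; lra.
by have : 0 < (1 + A) * (c ^+ 2 - 1); [rewrite mulr_gt0; lra | lra].
Qed.

(** Markov's inequality, with the integral of [q] evaluated by the fundamental theorem of
    calculus. *)
Lemma markov_antiderivative (R : realType) (G q : R -> R) (a b V : R) (E : set R) :
  a < b -> continuous q -> (forall t : R, is_derive t (1 : R) G (q t)) ->
  (forall t, a <= t <= b -> 0 <= q t) -> measurable E ->
  E `<=` `[a, b] -> (forall t, E t -> V <= q t) -> 0 <= V ->
  (V%:E * lebesgue_measure E <= (G b - G a)%:E)%E.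
Proof.
move=> ab cq dG q0 mE Eab VE V0.
have Gc : continuous G.
  by move=> t; apply: differentiable_continuous; apply/derivable1_diffP; case: (dG t).
have mq : measurable_fun setT q by exact: continuous_measurable_fun.
have -> : (G b - G a)%:E = (\int[lebesgue_measure]_(x in `[a, b]) (q x)%:E)%E.
  rewrite (@continuous_FTC2 _ q G) //.
  - exact: continuous_subspaceT.
  - split; first by move=> x _; case: (dG x).
      by apply: cvg_at_right_filter; apply: Gc.
    by apply: cvg_at_left_filter; apply: Gc.
  - by move=> x _; rewrite derive1E; case: (dG x).
rewrite -(integral_cst lebesgue_measure mE).
apply: (@le_trans _ _ (\int[lebesgue_measure]_(x in E) (q x)%:E)%E).
  apply: ge0_le_integral => //.
  by apply/measurable_EFinP; apply: measurable_funTS.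
apply: ge0_subset_integral => //.
by apply/measurable_EFinP; apply: measurable_funTS.
Qed.

Lemma continuous_bigsum (R : realType) (J : Type) (r : seq J) (g : J -> R -> R) :
  (forall i, continuous (g i)) -> continuous (fun u => \sum_(i <- r) g i u).
Proof.
move=> h; elim: r => [|i r IHr].
  rewrite (_ : (fun u => _) = cst 0); first exact: cst_continuous.
  by apply/funext => u; rewrite big_nil.
rewrite (_ : (fun u => _) = g i + (fun u => \sum_(i <- r) g i u)).
  by move=> t; apply: cvgD; [apply: h | apply: IHr].
by apply/funext => u; rewrite big_cons.
Qed.

Lemma continuous_cos_scale (R : realType) (c : R) : continuous (fun t => cos (c * t)).
Proof.
move=> t; apply: differentiable_continuous; apply/derivable1_diffP.
by case: (is_derive_cos_scale c t).
Qed.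

(** Chebyshev with the weight [A ^ 2 - t ^ 2], which is at least [A ^ 2 / 2] on the inner interval.
    The decay of its cosine transform reduces the mean square to a weighted count of pairs of
    frequencies. *)
Lemma large_values (R : realType) (A : R) : 0 < A -> exists2 C : R, 0 <= C &
  forall (I : finType) (x a : I -> R) (m V : R),
  (forall i, 0 <= a i <= m) -> (forall i, 0 <= x i) -> 0 < V ->
  let E := `[- (A / 2), A / 2] `&`
    [set t | V <= `|\sum_i a i * cos (2 * pi * x i * t)|] in
  measurable E /\
  (lebesgue_measure E <=
    (C * m ^+ 2 * (#|[set p : I * I | Num.truncn (x p.1) == Num.truncn (x p.2)]%SET|)%:R
      / V ^+ 2)%:E)%E.
Proof.
move=> A0; pose C0 := 4 * A ^+ 3 + 8 * (1 + A).
have A2 : 0 < A ^+ 2 by rewrite exprn_gt0.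
have A3 : 0 < A ^+ 3 by rewrite exprn_gt0.
have C00 : 0 <= C0 by rewrite /C0; lra.
(* 36 is the factor 3 for rounding frequencies to cells times the row sum 12. *)
exists (36 * C0 / (A ^+ 2 / 2)); first by apply: divr_ge0; lra.
move=> I x a m V am x0 V0 E; pose F t := \sum_i a i * cos (2 * pi * x i * t).
have cF : continuous F.
  apply: continuous_bigsum => i t; apply: cvgM; first exact: cvg_cst.
  exact: continuous_cos_scale.
have mE : measurable E.
  have mF : measurable_fun `[- (A / 2), A / 2] (Num.norm \o F).
    apply: subspace_continuous_measurable_fun => //; apply: continuous_subspaceT => t.
    by apply: continuous_comp; [exact: cF | exact: norm_continuous].
  rewrite (_ : E = `[- (A / 2), A / 2] `&` (Num.norm \o F) @^-1` `[V, +oo[).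
    by apply: mF => //; exact: measurable_itv.
  by rewrite /E; congr (_ `&` _); apply/seteqP; split=> t /=; rewrite in_itv /= andbT.
split=> //.
have [G hG] := choice (fun c => cos_window c A0).
pose cc (p : I * I) := 2 * pi * x p.1 - 2 * pi * x p.2.
pose Phi t := \sum_(p : I * I) a p.1 * a p.2 * G (cc p) t.
pose q t := \sum_(p : I * I) a p.1 * a p.2 * ((A ^+ 2 - t ^+ 2) * cos (cc p * t)).
have dPhi t : is_derive t (1 : R) Phi (q t).
  by apply: is_derive_bigsum => p; apply: is_deriveZ; case: (hG (cc p)).
have cq : continuous q.
  apply: continuous_bigsum => p t; apply: cvgM; first exact: cvg_cst.
  apply: cvgM; last exact: continuous_cos_scale.
  by apply: cvgB; [exact: cvg_cst | exact: exprn_continuous].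
(* Adding the square of the sine sum completes [F ^ 2] to the squared modulus of an exponential sum,
   whose expansion involves only differences of frequencies. *)
have qE t : q t = (A ^+ 2 - t ^+ 2) *
    (F t ^+ 2 + (\sum_i a i * sin (2 * pi * x i * t)) ^+ 2).
  rewrite /q -(pair_big xpredT xpredT (fun i j => a i * a j * ((A ^+ 2 - t ^+ 2) * cos (cc (i, j) * t)))) /=.
  rewrite !expr2 /F !mulr_suml -big_split /= mulr_sumr; apply: eq_bigr => i _.
  rewrite !mulr_sumr -big_split /= mulr_sumr; apply: eq_bigr => j _.
  by rewrite /cc /= [in cos _]mulrBl cosB; ring.
have hMarkov : ((A ^+ 2 / 2 * V ^+ 2)%:E * lebesgue_measure E <= (Phi A - Phi (- A))%:E)%E.
  apply: (@markov_antiderivative R Phi q) => //.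
  - lra.
  - move=> t /andP[t1 t2]; rewrite qE; apply: mulr_ge0; last by rewrite addr_ge0 ?sqr_ge0.
    have : 0 <= (A - t) * (A + t) by apply: mulr_ge0; lra.
    by lra.
  - by move=> t [+ _]; rewrite /= !in_itv /= => /andP[? ?]; apply/andP; split; lra.
  - move=> t [+ /= Vt]; rewrite /= in_itv /= => /andP[t1 t2]; rewrite qE.
    have tA : A ^+ 2 / 2 <= A ^+ 2 - t ^+ 2 by nra.
    have VF : V ^+ 2 <= F t ^+ 2.
      by rewrite -[F t ^+ 2]real_normK ?num_real // lerXn2r ?nnegrE // ltW.
    apply: ler_pM => //; rewrite ?sqr_ge0 //; first lra.
    by rewrite (le_trans VF) // lerDl sqr_ge0.
  - by rewrite mulr_ge0 ?sqr_ge0 //; lra.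
have A2' : 0 < A ^+ 2 / 2 by lra.
have V2 : 0 < V ^+ 2 by rewrite exprn_gt0.
have -> : forall N : R, 36 * C0 / (A ^+ 2 / 2) * m ^+ 2 * N / V ^+ 2 =
    (A ^+ 2 / 2 * V ^+ 2)^-1 * (36 * C0 * m ^+ 2 * N).
  by move=> N; field; rewrite !lt0r_neq0.
rewrite EFinM lee_pdivlMl ?mulr_gt0 //; apply: (le_trans hMarkov).
rewrite lee_fin /Phi -sumrB.
have -> : 36 * C0 * m ^+ 2 = (m ^+ 2 * (3 * C0)) * 12 by ring.
rewrite -mulrA; apply: le_trans (ler_wpM2l _ (sum_cells_le R (fun i => Num.truncn (x i)))); last first.
  by rewrite mulr_ge0 ?sqr_ge0 //; lra.
rewrite pair_big /= mulr_sumr; apply: ler_sum => p _.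
rewrite -mulrBr.
have /andP[a10 a1m] := am p.1; have /andP[a20 a2m] := am p.2.
have d0 : 0 <= (1 + (distn (Num.truncn (x p.1)) (Num.truncn (x p.2)))%:R ^+ 2 : R)^-1.
  by rewrite invr_ge0 addr_ge0 ?sqr_ge0.
have hW : G (cc p) A - G (cc p) (- A) <=
    3 * C0 * (1 + (distn (Num.truncn (x p.1)) (Num.truncn (x p.2)))%:R ^+ 2)^-1.
  have [_ h] := hG (cc p); apply: (le_trans h); rewrite -/C0.
  have dt := distn_truncn (x0 p.1) (x0 p.2).
  have pos1 : 0 < 1 + cc p ^+ 2 by rewrite ltr_pwDl ?sqr_ge0.
  have pos2 : 0 < 1 + (distn (Num.truncn (x p.1)) (Num.truncn (x p.2)))%:R ^+ 2 :> R.
    by rewrite ltr_pwDl ?sqr_ge0.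
  rewrite ler_pdivrMr // mulrAC ler_pdivlMr // [3 * C0]mulrC -mulrA ler_wpM2l //.
  apply: (le_trans dt); rewrite ler_pM2l // lerD2l.
  have -> : cc p ^+ 2 = (2 * pi) ^+ 2 * (x p.1 - x p.2) ^+ 2 by rewrite /cc; ring.
  rewrite ler_peMl ?sqr_ge0 // -[leLHS](expr1n _ 2) lerXn2r ?nnegrE //.
    by have := pi_ge2 R; lra.
  by have := pi_ge2 R; lra.
apply: (@le_trans _ _ (a p.1 * a p.2 * (3 * C0 * (1 + (distn (Num.truncn (x p.1)) (Num.truncn (x p.2)))%:R ^+ 2)^-1))).
  by rewrite ler_wpM2l // mulr_ge0.
rewrite -(mulrA (m ^+ 2)) ler_wpM2r //.
  by rewrite mulr_ge0 //; lra.
by rewrite expr2 ler_pM.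
Qed.

(** The product is the gap [x_(n+d) - x_n]. For [N = (2 ^ j) ^ r] the tolerance is
    [N ^ -(2 - 5 / r)]. *)
Definition gap_hit (R : realType) (a b : R) (r : nat) (alpha : R) (j : nat) : Prop :=
  exists d n : nat, [/\ (0 < d)%N, (0 < n)%N, (n + d <= 3 * (2 ^ j) ^ r)%N &
    exists z : int, `|alpha * (d%:R * (a * (2 * n + d)%:R + b)) - z%:~R| <
      ((2 ^ j)%:R ^+ (2 * r - 5))^-1].

(** [E] collects the [alpha] for which the oscillating part of the kernel, summed over all [N ^ 2]
    gaps, has size at least [V]. Without a hit each gap contributes at most [- c0 / 4] to this sum,
    which forces [alpha] into [E]. *)
Lemma bad_set (R : realType) (a b A : R) (r : nat) : 0 < a -> 0 < A -> (2 < r)%N ->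
  exists2 C : R, 0 <= C & exists j0 : nat, forall j, exists E : set R,
  measurable E /\ ((j0 <= j)%N ->
    (lebesgue_measure E <= (C / (2 ^ j)%:R)%:E)%E /\
    forall alpha, `|alpha| <= A / 2 -> ~ E alpha ->
      gap_hit a b r alpha j).
Proof.
move=> a0 A0 r2.
have sum_le m (i k : 'I_m) : (m + k.+1 + i.+1 <= 3 * m)%N.
  by have := ltn_ord i; have := ltn_ord k; lia.
have r0 : (0 < r)%N by lia.
have r4 : (r * 4 = (4 * r - 1).+1)%N by lia.
have rr : ((2 * r - 4) * (2 * r) = 4 + ((2 * r - 4) + (2 * r - 5) * (2 * r)))%N.
  by rewrite addnA -(_ : 2 * r = 4 + (2 * r - 4))%N; [rewrite -mulSn; congr (_ * _)%N; lia | lia].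
have [C1 C10 hC1] := large_values A0.
have [C2 C20 [j1 hC2]] := card_same_cell_le b a0 r2.
exists (16 * C1 * C2); first by rewrite !mulr_ge0.
exists (maxn j1 (2 * r * 4 ^ r)) => j.
(* Below the threshold only measurability is asked for, so the empty set serves. *)
have [jj|_] := leqP (maxn j1 (2 * r * 4 ^ r)) j; last by exists set0; split.
move: jj; rewrite geq_max => /andP[jj1 jj2].
have := hC2 j jj1; set q := (2 ^ j)%N; set H := (q ^ (2 * r - 4))%N.
set L := (r * H)%N; set N := (q ^ r)%N => /= -[x0 hX].
have q0 : (0 < q)%N by rewrite expn_gt0.
have Q0 : 0 < q%:R :> R by rewrite ltr0n.
have q4 : (2 * r * 4 ^ r <= q ^ 4)%N.
  apply: (leq_trans jj2); apply: (leq_trans (ltnW (ltn_expl j (ltnSn 1)))).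
  by rewrite -{1}(expn1 (2 ^ j)) leq_pexp2l.
have H0 : (0 < H)%N by rewrite expn_gt0 q0.
have [c0 [c [c0H hc hK]]] := kernel_exists R H0 r0.
have c0_gt0 : 0 < c0.
  have : 0 < (r * H)%:R * c0 by apply: lt_le_trans c0H; rewrite exprn_gt0 // ltr0n.
  by rewrite pmulr_rgt0 // ltr0n muln_gt0 r0.
have N0 : 0 < N%:R :> R by rewrite ltr0n expn_gt0 q0.
pose V := N%:R ^+ 2 * c0 / 4.
have V0 : 0 < V by rewrite divr_gt0 // mulr_gt0 // exprn_gt0.
have [mE muE] := hC1 (gap_index L N) (@gap_freq R a b L N) (fun p => c p.1) c0 V
  (fun p => hc p.1) x0 V0.
eexists; split; first exact: mE.
move=> _; split.
  apply: (le_trans muE); rewrite lee_fin.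
  set X := _%:R in hX *.
  (* The mean [c0] cancels, leaving the number of pairs in a common cell over [N ^ 4]. *)
  have -> : C1 * c0 ^+ 2 * X / V ^+ 2 = 16 * C1 * X / N%:R ^+ 4.
    by rewrite /V; field; rewrite !gt_eqF.
  have -> : 16 * C1 * C2 / q%:R = 16 * C1 * (C2 * q%:R ^+ (4 * r - 1)) / N%:R ^+ 4.
    rewrite /N natrX -exprM r4.
    by rewrite exprS; field; rewrite expf_neq0 gt_eqF.
  rewrite ler_wpM2r ?invr_ge0 ?exprn_ge0 //.
  by rewrite ler_wpM2l // mulr_ge0.
move=> alpha alphaA nE; apply: contrapT => nhit; apply: nE.
split; first by rewrite /= in_itv /=; rewrite ler_norml in alphaA.
pose lam (p : 'I_N * 'I_N) := p.1.+1%:R * (a * (2 * (N + p.2.+1) + p.1.+1)%:R + b).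
pose Y (p : 'I_N * 'I_N) := \sum_(h < L) c h * cos (h.+1%:R * (2 * pi * (alpha * lam p))).
change (V <= `|\sum_(p : gap_index L N) c p.1 * cos (2 * pi * gap_freq a b p * alpha)|).
have -> : \sum_(p : gap_index L N) c p.1 * cos (2 * pi * gap_freq a b p * alpha) = \sum_p Y p.
  rewrite /Y exchange_big /= pair_big /=; apply: eq_bigr => p _.
  by congr (_ * cos _); rewrite /gap_freq /lam; ring.
have hY p : Y p <= - (c0 / 4).
  pose e : R := (q%:R ^+ (2 * r - 5))^-1.
  have e0 : 0 < e by rewrite invr_gt0 exprn_gt0.
  have far (z : int) : e <= `|alpha * lam p - z%:~R|.
    rewrite leNgt; apply/negP => hz; apply: nhit.
    exists p.1.+1, (N + p.2.+1)%N; split => //; first by rewrite addnS.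
    by exists z.
  have w := sqr_le_2B2cos_dist (ltW e0) far.
  have := hK (2 * pi * (alpha * lam p)); rewrite -/(Y p) => hKp.
  rewrite leNgt; apply/negP => hY.
  have hlow : c0 / 2 < c0 + 2 * Y p by lra.
  have : c0 / 2 * (e ^+ 2) ^+ r < 4 ^+ r.
    apply: lt_le_trans hKp; apply: lt_le_trans (_ : (c0 + 2 * Y p) * (e ^+ 2) ^+ r <= _).
      by rewrite ltr_pM2r // !exprn_gt0.
    rewrite ler_wpM2l //; first by apply: ltW; apply: lt_trans hlow; lra.
    by rewrite lerXn2r ?nnegrE ?sqr_ge0 // (le_trans _ w) ?sqr_ge0.
  apply/negP; rewrite -leNgt.
  have R0 : 0 < (r * H)%:R :> R by rewrite ltr0n muln_gt0 r0.
  rewrite -(ler_pM2l R0).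
  have -> : (r * H)%:R * (c0 / 2 * (e ^+ 2) ^+ r) = (r * H)%:R * c0 * ((e ^+ 2) ^+ r / 2) by ring.
  apply: le_trans (ler_wpM2r _ c0H); last by rewrite divr_ge0 // !exprn_ge0 // ltW.
  rewrite mulrA ler_pdivlMr // -!exprM /e exprVn ler_pdivlMr; last by rewrite !exprn_gt0.
  rewrite -exprM -!natrX -!natrM ler_nat.
  (* [H] exceeds the inverse tolerance by one factor [q], and [q ^ (2 r) = q ^ 4 H]: the factor [H]
     pays for [r H] in the lower bound for [c0], and [q ^ 4] pays for the constant [2 r 4 ^ r]. *)
  have -> : (H ^ (2 * r) = q ^ 4 * (H * q ^ ((2 * r - 5) * (2 * r))))%N.
    by rewrite /H -expnM -!expnD rr.
  have -> : (r * H * 4 ^ r * 2 * q ^ ((2 * r - 5) * (2 * r)) =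
     (2 * r * 4 ^ r) * (H * q ^ ((2 * r - 5) * (2 * r))))%N by ring.
  by rewrite leq_mul2r q4 orbT.
have hsum : \sum_p Y p <= - V.
  apply: (@le_trans _ _ (\sum_(p : 'I_N * 'I_N) - (c0 / 4))); first by apply: ler_sum.
  rewrite sumr_const card_prod card_ord -[leLHS]mulr_natr natrM /V expr2.
  by rewrite le_eqVlt; apply/orP; left; apply/eqP; field.
by rewrite -normrN; apply: le_trans (ler_norm _); rewrite lerNr.
Qed.

(** * Almost every dilate *)

(** Borel-Cantelli on each of countably many bounded ranges of [alpha]: the exceptional sets have
    measure O(2^(-j)), so almost every [alpha] lies in only finitely many of them. *)
Lemma ae_gap_hit (R : realType) (a b : R) (r : nat) : 0 < a -> (2 < r)%N ->
  {ae @lebesgue_measure R, forall alpha : R,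
    exists J, forall j, (J <= j)%N -> gap_hit a b r alpha j}.
Proof.
move=> a0 r2; pose P (alpha : R) := exists J, forall j, (J <= j)%N -> gap_hit a b r alpha j.
suff hm m : (@lebesgue_measure R).-negligible [set alpha : R | `|alpha| <= m.+1%:R / 2 /\ ~ P alpha].
  apply: (negligibleS _ (negligible_bigcup hm)) => alpha /= nP.
  exists (Num.truncn (2 * `|alpha|)) => //=; split=> //.
  by rewrite ler_pdivlMr // mulrC ltW // truncnS_gt.
have [C C0 [j0 hE]] := bad_set b a0 (ltr0Sn R m) r2.
have [E {}hE] := choice hE.
(* The shift makes the measure bound valid from index 0 on. *)
pose F j := E (j + j0)%N.
have mF j : measurable (F j) by case: (hE (j + j0)%N).
have muF j : (lebesgue_measure (F j) <= (C * 2 / (2 ^ (j + 1))%:R)%:E)%E.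
  have [_ /(_ (leq_addl _ _))[h _]] := hE (j + j0)%N.
  apply: (le_trans h); rewrite lee_fin addn1 expnS natrM invfM mulrA mulfK //.
  by rewrite ler_wpM2l // lef_pV2 ?posrE ?ltr0n ?expn_gt0 // ler_nat leq_pexp2l // leq_addr.
have sumF : (\sum_(n <oo) lebesgue_measure (F n) < +oo)%E.
  apply: (@le_lt_trans _ _ (\sum_(n <oo) (C * 2 / (2 ^ (n + 1))%:R)%:E)%E).
    by apply: lee_nneseries => // n _.
  by rewrite (cvg_lim _ (@cvg_geometric_eseries_half R (C * 2) 0)) // ltry.
have null : lebesgue_measure (lim_sup_set F) = 0%E by apply: lim_sup_set_cvg0.
exists (lim_sup_set F); split => //.
  by apply: bigcapT_measurable => k; apply: bigcup_measurable => i _; exact: mF.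
move=> alpha [am nP] n _ /=; apply: contrapT => nF; apply: nP.
exists (n + j0)%N => j nj.
have jE : j = ((j - j0) + j0)%N by rewrite subnK // (leq_trans (leq_addl _ _) nj).
rewrite jE; have [_ /(_ (leq_addl _ _))[_ h]] := hE ((j - j0) + j0)%N.
apply: h => // hEj; apply: nF; exists (j - j0)%N => //=.
by rewrite leq_subRL ?(leq_trans (leq_addl _ _) nj) // addnC.
Qed.

(** * From gap hits to the minimal gap and its exponent *)

Lemma dist_int_le (R : realType) (x : R) (z : int) : dist_int x <= `|x - z%:~R|.
Proof.
apply: ge_inf; first by exists 0 => _ [k _ <-].
by exists z.
Qed.

Lemma dist_int_ge0 (R : realType) (x : R) : 0 <= dist_int x.
Proof.
by apply: lb_le_inf => [|_ [k _ <-] //]; exists `|x - 0%:~R|; exists 0.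
Qed.

Lemma delta_min_le (R : realType) (x : nat -> R) (alpha : R) (N m n : nat) :
  (1 <= m <= N)%N -> (1 <= n <= N)%N -> m != n ->
  delta_min x alpha N <= dist_int (alpha * x m - alpha * x n).
Proof.
move=> mN nN mn; apply: ge_inf; first by exists 0 => _ [k _ <-]; exact: dist_int_ge0.
by exists (m, n).
Qed.

Lemma delta_min_ge0 (R : realType) (x : nat -> R) (alpha : R) (N : nat) :
  (1 < N)%N -> 0 <= delta_min x alpha N.
Proof.
move=> N1; apply: lb_le_inf => [|_ [k _ <-]]; last exact: dist_int_ge0.
by exists (dist_int (alpha * x 1%N - alpha * x 2)), (1%N, 2) => //=; split => //=; lia.
Qed.

(** Negating [a] and [b] negates every gap, which amounts to exchanging the two indices; this
    reduces [a < 0] to a positive leading coefficient. *)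
Lemma delta_min_gap_hit (R : realType) (a b c alpha : R) (r j N : nat) :
  a != 0 -> gap_hit `|a| (Num.sg a * b) r alpha j -> (3 * (2 ^ j) ^ r <= N)%N ->
  delta_min (quad_seq a b c) alpha N < ((2 ^ j)%:R ^+ (2 * r - 5))^-1.
Proof.
move=> a_neq0 [d [n [d0 n0 ndN [z hz]]]] hN.
have dN : (1 <= n + d <= N)%N by rewrite (leq_trans ndN) // addn_gt0 n0.
have nN : (1 <= n <= N)%N by rewrite n0; case/andP: dN => _; apply: leq_trans; rewrite leq_addr.
have dn : (n + d != n)%N by lia.
have E : quad_seq a b c (n + d) - quad_seq a b c n =
    d%:R * (a * (2 * n + d)%:R + b) by rewrite /quad_seq !(natrD, natrM); ring.
apply: le_lt_trans hz.
move: a_neq0; rewrite neq_lt => /orP[a0|a0].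
  rewrite (ltr0_norm a0) (ltr0_sg a0) mulN1r.
  apply: (le_trans (delta_min_le _ alpha nN dN _)); first by rewrite eq_sym.
  have -> : alpha * quad_seq a b c n - alpha * quad_seq a b c (n + d) =
      alpha * (d%:R * (- a * (2 * n + d)%:R - b)).
    by rewrite -mulrBr -opprB E; ring.
  exact: dist_int_le.
rewrite (gtr0_norm a0) (gtr0_sg a0) mul1r.
apply: (le_trans (delta_min_le _ alpha dN nN dn)).
by rewrite -mulrBr E dist_int_le.
Qed.

(* For [3 * 2 ^ (r j) <= N < 3 * 2 ^ (r (j + 1))] one has
   [N ^ (2 r - 6) <= 2 ^ (r j (2 r - 5))] once [j >= 2 (r + 2)]. *)
Lemma delta_min_pow (R : realType) (a b c alpha : R) (r : nat) : a != 0 -> (2 < r)%N ->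
  (exists J, forall j, (J <= j)%N -> gap_hit `|a| (Num.sg a * b) r alpha j) ->
  \forall N \near \oo,
    (N%:R ^+ 2 * delta_min (quad_seq a b c) alpha N) ^+ r <= N%:R ^+ 6.
Proof.
move=> a0 r2 [J hJ]; pose J' := maxn J (2 * (r + 2)).
exists (3 * (2 ^ J') ^ r)%N => // N /= hN.
have r0 : (0 < r)%N by lia.
pose P j := (3 * (2 ^ j) ^ r <= N)%N.
have Pbound j : P j -> (j <= N)%N.
  apply: leq_trans; rewrite -expnM (leq_trans (ltnW (ltn_expl j (ltnSn 1)))) //.
  apply: (@leq_trans (2 ^ (j * r))%N); last by rewrite leq_pmull.
  by rewrite leq_pexp2l // leq_pmulr.
have exP : exists j, P j by exists J'.
case: (ex_maxnP exP Pbound) => j Pj jmax.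
have Jj : (J' <= j)%N by apply: jmax.
have Nlt : (N < 3 * (2 ^ j.+1) ^ r)%N.
  by rewrite ltnNge; apply/negP => /jmax; rewrite ltnn.
have := delta_min_gap_hit c a0 (hJ j (leq_trans (leq_maxl _ _) Jj)) Pj.
have N1 : (1 < N)%N.
  by apply: leq_trans Pj; rewrite (@leq_trans (3 * 1)%N) // leq_mul2l expn_gt0 expn_gt0.
have := delta_min_ge0 (quad_seq a b c) alpha N1.
move: (delta_min _ _ _) => delta delta0 delta_lt.
(* [N] is below [2 ^ (r j + r + 2)] by maximality of [j], and the excess [(r + 2) (2 r - 6)] in the
   exponent is at most [r j]. *)
have hNj : (N ^ (2 * r - 6) <= (2 ^ j) ^ ((2 * r - 5) * r))%N.
  apply: (@leq_trans ((2 ^ (r * j + r + 2)) ^ (2 * r - 6))%N).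
    case: (posnP (2 * r - 6)) => [->|p0]; first by rewrite !expn0.
    rewrite leq_exp2r // (leq_trans (ltnW Nlt)) // -expnM.
    apply: (@leq_trans (2 ^ 2 * 2 ^ (j.+1 * r))%N); first by rewrite leq_mul2r orbT.
    by rewrite -expnD leq_pexp2l //; nia.
  rewrite -!expnM leq_pexp2l //.
  have hj : (2 * (r + 2) <= j)%N by apply: leq_trans Jj; exact: leq_maxr.
  have -> : (2 * r - 5 = (2 * r - 6) + 1)%N by lia.
  have h1 : (2 * r - 6 <= 2 * r)%N by rewrite leq_subr.
  have h2 : ((r + 2) * (2 * r - 6) <= r * j)%N.
    by apply: (@leq_trans (r * (2 * (r + 2)))%N); [nia | rewrite leq_mul2l hj orbT].
  by move: h2; move: (2 * r - 6)%N => e; nia.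
have N0 : 0 < N%:R :> R by rewrite ltr0n (ltn_trans _ N1).
have dr : delta ^+ r <= ((2 ^ j)%:R ^+ ((2 * r - 5) * r))^-1.
  by rewrite exprM -exprVn lerXn2r ?nnegrE ?invr_ge0 ?exprn_ge0 // ltW.
rewrite exprMn -exprM.
have -> : (2 * r = 6 + (2 * r - 6))%N by lia.
rewrite exprD -mulrA ler_piMr ?exprn_ge0 //.
apply: (@le_trans _ _ (N%:R ^+ (2 * r - 6) * ((2 ^ j)%:R ^+ ((2 * r - 5) * r))^-1)).
  by rewrite ler_wpM2l // exprn_ge0.
rewrite ler_pdivrMr ?mul1r; last by rewrite exprn_gt0 // ltr0n expn_gt0.
by rewrite -!natrX ler_nat.
Qed.

(** The hypothesis says [delta N <= N ^ -(2 - 6 / r)] eventually, written without real exponents.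
    One function [f] serves every [r], because it is read off from [delta] itself. *)
Lemma exponent_of_pow_bounds (R : realType) (delta : nat -> R) :
  (forall r, (2 < r)%N -> \forall N \near \oo, (N%:R ^+ 2 * delta N) ^+ r <= N%:R ^+ 6) ->
  exists f : nat -> R, f @ \oo --> (0 : R) /\
    \forall N \near \oo, delta N < N%:R `^ (- (2 - f N)).
Proof.
move=> hdelta.
(* The maximum with 1 keeps the logarithm defined and nonnegative even if [delta N] is zero; the
   summand [N^-1] in [f] makes the final inequality strict. *)
pose M (N : nat) : R := Num.max (N%:R ^+ 2 * delta N) 1.
have M1 N : 1 <= M N by rewrite le_max lexx orbT.
pose f (N : nat) : R := N%:R^-1 + ln (M N) / ln N%:R.
exists f; split.
  apply/cvgrPdist_lt => e e0.
  (* Chosen so that [r > 2] and [6 / r < e / 2]. *)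
  pose r := (Num.truncn (12 / e)).+3.
  have re : 12 / e < r%:R.
    by apply: (lt_trans (truncnS_gt _)); rewrite ltr_nat.
  have r0 : 0 < r%:R :> R by [].
  have e12 : 6 / r%:R < e / 2.
    by rewrite ltr_pdivrMr // mulrAC ltr_pdivlMr //; move: re; rewrite ltr_pdivrMr //; lra.
  near=> N.
  have N1 : (1 < N)%N by near: N; exists 2%N.
  have N1' : 1 < N%:R :> R by rewrite ltr1n.
  have lnN : 0 < ln N%:R :> R by rewrite ln_gt0.
  have Ne : N%:R^-1 < e / 2.
    rewrite invf_plt ?posrE ?divr_gt0 //; last by lra.
    apply: (lt_le_trans (truncnS_gt _)); rewrite ler_nat.
    by near: N; exists (Num.truncn ((e / 2)^-1)).+1.
  have Mr : M N ^+ r <= N%:R ^+ 6.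
    rewrite /M maxEle; case: ifP => _; first by rewrite expr1n exprn_ege1 // ltW.
    by near: N; apply: hdelta.
  have lnM : ln (M N) / ln N%:R <= 6 / r%:R.
    rewrite ler_pdivrMr // mulrAC ler_pdivlMr //.
    have : ln (M N ^+ r) <= ln (N%:R ^+ 6).
      by rewrite ler_ln ?posrE ?exprn_gt0 // ?(lt_le_trans _ (M1 N)) //; lra.
    rewrite !lnXn ?(lt_le_trans _ (M1 N)) //; last by lra.
    by rewrite !mulr_natr => h; rewrite mulr_natl.
  have f0 : 0 <= f N.
    rewrite addr_ge0 ?invr_ge0 // divr_ge0 ?ln_ge0 //; exact: ltW.
  by rewrite sub0r normrN ger0_norm // /f; lra.
near=> N.
have N1 : (1 < N)%N by near: N; exists 2%N.
have N1' : 1 < N%:R :> R by rewrite ltr1n.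
have lnN : 0 < ln N%:R :> R by rewrite ln_gt0.
have N0 : 0 < N%:R :> R by lra.
rewrite /powR gt_eqF //.
have -> : - (2 - f N) * ln N%:R = ln (M N) + N%:R^-1 * ln N%:R - 2 * ln N%:R.
  by rewrite /f; field; rewrite !gt_eqF.
have M0 : 0 < M N by apply: lt_le_trans (M1 N).
have x0 : 0 < N%:R^-1 * ln N%:R :> R by rewrite mulr_gt0 // invr_gt0.
have -> : 2 * ln N%:R = ln (N%:R ^+ 2) :> R by rewrite lnXn // mulr_natl.
rewrite !expRD expRN !lnK ?posrE ?exprn_gt0 // ltr_pdivlMr ?exprn_gt0 //.
apply: (@le_lt_trans _ _ (M N)); first by rewrite mulrC le_max lexx.
by rewrite ltr_pMr // expR_gt1.
Unshelve. all: by end_near.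
Qed.

Theorem theorem6 (R : realType) (a b c : R) :
  a != 0 ->
  {ae (@lebesgue_measure R), forall alpha : R,
    exists f : nat -> R,
      f @ \oo --> (0 : R) /\
      \forall N \near \oo,
        delta_min (quad_seq a b c) alpha N < N%:R `^ (- (2 - f N))}.
Proof.
move=> a0.
(* The countably many null sets, one for each exponent [r.+3], are united, so that a single [alpha]
   satisfies the bounds for all [r > 2]. *)
have hits r : {ae @lebesgue_measure R, forall alpha : R,
    exists J, forall j, (J <= j)%N -> gap_hit `|a| (Num.sg a * b) r.+3 alpha j}.
  by apply: ae_gap_hit; rewrite ?normr_gt0.
apply: (negligibleS _ (negligible_bigcup hits)) => alpha /= bad.
apply: contrapT => good; apply: bad; apply: exponent_of_pow_bounds => r r2.
apply: delta_min_pow => //; apply: contrapT => nhit; apply: good.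
by exists (r - 3)%N => //=; rewrite (_ : (r - 3).+3 = r) //; lia.
Qed.
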